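(* There is a positive absolute constant $c$ such that the following holds. Let $p$ be a prime and $n$ a positive integer with $5n < \log_2\log_6\log_{18} p - 1$, and let $\mathcal{P}$ be a set of points and $\mathcal{L}$ a set of lines in $\mathbb{F}_p^2$ with $|\mathcal{P}|, |\mathcal{L}| \leq n$. Then $$|\{(q, l) \in \mathcal{P} \times \mathcal{L} : q \in l\}| \leq cn^{4/3}.$$ Moreover, this inequality is sharp up to the constant $c$: there is an absolute constant $c'>0$ such that for every such $p$ and every $n\geq 8$ with $5n < \log_2\log_6\log_{18} p - 1$ there exist a set $\mathcal{P}$ of points and a set $\mathcal{L}$ of lines in $\mathbb{F}_p^2$ with $|\mathcal{P}|,|\mathcal{L}|\leq n$ and at least $c' n^{4/3}$ incidences.
   Context: A line in $\mathbb{F}_p^2$ is a set of the form $\{(x,y)\in\mathbb{F}_p^2 : ay+bx+c=0\}$ with $(a,b)\neq(0,0)$. *)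

(* Defs.v *)
From mathcomp Require Import all_boot all_order all_algebra.
From mathcomp Require Import reals exp.

Set Implicit Arguments.
Unset Strict Implicit.
Unset Printing Implicit Defensive.

Import Order.TTheory GRing.Theory Num.Theory.
Local Open Scope ring_scope.

(* Since [ln x = 0] for [x <= 0], an iterated logarithm with a nonpositive inner
   value is 0; a hypothesis [5 * n%:R < logb _ _ - 1] then fails. *)
Definition logb (R : realType) (b x : R) : R := ln x / ln b.

Definition is_line (F : finFieldType) (l : {set F * F}) : Prop :=
  exists a b c : F, (a, b) <> (0, 0) /\
    l = [set q : F * F | a * q.2 + b * q.1 + c == 0].

Definition incidences (F : finFieldType) (P : {set F * F})
    (L : {set {set F * F}}) : {set (F * F) * {set F * F}} :=
  [set ql in setX P L | ql.1 \in ql.2].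

(* Main.v *)
Require Import Defs.
From mathcomp Require Import all_boot all_order all_algebra perm.
From mathcomp Require Import boolp reals exp.
From mathcomp Require Import complex ring lra zify.

Set Implicit Arguments.
Unset Strict Implicit.
Unset Printing Implicit Defensive.

Import Order.TTheory GRing.Theory Num.Theory.
Local Open Scope ring_scope.

(** Upper bound.  A configuration of at most [n] points is described by the
    vanishing and nonvanishing of the determinants of its triples of points.
    Eliminating the [2 n] coordinates one at a time, with minors of Sylvester
    type matrices and a doubly exponential control of degrees and coefficients,
    shows that for [p] this large the same determinantal conditions have a
    solution over the complex numbers, so it suffices to prove the
    Szemeredi-Trotter theorem in the complex plane.

    There, let [n] lines be given and consider the points on at least [d] of
    them.  Take a smallest disc of slopes holding a small fixed proportion of
    the lines.  The points having few lines with slope in the disc, or few with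
    slope outside a ten times larger concentric disc, are counted by induction
    on [n]: the numbers [n1], [n2] of remaining lines satisfy
    [n1 ^ 2 + n2 ^ 2 < n ^ 2].  The other points lie on many lines of two
    transversal families.  For a point [p] of a line [l], consider the disc of
    [l] around [p] reaching to the nearest other point of [l]; on a fixed line
    these discs overlap boundedly, so few pairs [(p, l)] have about [d ^ 2]
    lines of the other family crossing the disc.  But every [p] has many such
    lines [l] in one of the families: otherwise the lines of a family through
    the neighbours of [p] cross the lines of the other family through [p] much
    closer to [p], relative to the distance of the neighbours, and applying
    this in both directions is contradictory.

    Lower bound.  The points [(x, y)] with [x < k], [y < 2 k ^ 2] and the lines
    [y = a x + b] with [a < k], [b < k ^ 2] have [k ^ 4] incidences. *)

(** * Finite partial linear spaces *)

Section FinsetFacts.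
Variable T : finType.
Implicit Types A : {set T}.

Lemma finset_ind (P : {set T} -> Prop) :
  P set0 -> (forall a A, a \notin A -> P A -> P (a |: A)) -> forall A, P A.
Proof.
move=> P0 PU A; have [n] := ubnP #|A|; elim: n A => // n IH A ltAn.
have [->|[a aA]] := set_0Vmem A; first exact: P0.
rewrite -(setD1K aA); apply: PU; first by rewrite !inE eqxx.
by apply: IH; move: ltAn; rewrite (cardsD1 a A) aA.
Qed.

Lemma leq_card_bigcup (I : finType) (r : {pred I}) (F : I -> {set T}) :
  (#|\bigcup_(i in r) F i| <= \sum_(i in r) #|F i|)%N.
Proof.
elim/big_rec2: _ => [|i n S _ IH]; first by rewrite cards0.
by apply: leq_trans (leq_card_setU _ _) _; rewrite leq_add2l.
Qed.

Lemma exists_subset_card A k :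
  (k <= #|A|)%N -> exists2 B : {set T}, B \subset A & #|B| = k.
Proof.
move=> leqkA; exists [set a in take k (enum A)].
  by apply/subsetP => a; rewrite inE => /mem_take; rewrite mem_enum.
rewrite cardsE (card_uniqP _) ?take_uniq ?enum_uniq // size_take -cardE.
by case: ltngtP leqkA => // ->.
Qed.

Lemma exists_subset_ceil (R : realFieldType) A (u : R) : 0 <= u -> u <= #|A|%:R ->
  exists B : {set T}, [/\ B \subset A, u <= #|B|%:R & #|B|%:R <= u + 1].
Proof.
move=> u_ge0 leuA; have [k leuk kmin] := ex_minnP (ex_intro (fun k => u <= k%:R) _ leuA).
have [B sBA cardB] := exists_subset_card (kmin _ leuA).
exists B; rewrite cardB; split=> //; case: k kmin {leuk cardB} => [|k] kmin.
  by rewrite addr_ge0.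
by rewrite -natr1 lerD2r leNgt; apply/negP => /ltW /kmin; rewrite ltnn.
Qed.

End FinsetFacts.

Section PartialLinearSpace.
Variables (PT LT : finType) (inc : PT -> LT -> bool).
Implicit Types (A S : {set LT}) (Q : {set PT}) (p q : PT) (l m : LT).

Definition partial_linear_space : Prop := forall p q l m,
  p != q -> inc p l -> inc q l -> inc p m -> inc q m -> l = m.

Definition pencil A p : {set LT} := [set l in A | inc p l].

Lemma pencil_subset A p : pencil A p \subset A.
Proof. by apply/subsetP => l; rewrite inE => /andP[]. Qed.

Lemma card_pencilD (R : realFieldType) S A p : A \subset S ->
  #|pencil (S :\: A) p|%:R = #|pencil S p|%:R - #|pencil A p|%:R :> R.
Proof.
move=> /subsetP sAS.
have -> : pencil (S :\: A) p = pencil S p :\: pencil A p.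
  by apply/setP => l; rewrite !inE; case: (l \in A); case: (inc p l); rewrite ?andbF.
have sAp : pencil A p \subset pencil S p.
  by apply/subsetP => l; rewrite !inE => /andP[/sAS -> ->].
by rewrite cardsD (setIidPr sAp) natrB ?subset_leq_card.
Qed.

Hypothesis linear_inc : partial_linear_space.

Lemma card_pencilI_le1 A p q : p != q -> (#|pencil A p :&: pencil A q| <= 1)%N.
Proof.
move=> npq; apply/card_le1_eqP => l m; rewrite !inE.
move=> /andP[/andP[_ pl] /andP[_ ql]] /andP[/andP[_ pm] /andP[_ qm]].
exact: linear_inc npq pm qm pl ql.
Qed.

Lemma sum_card_pencil_le A Q :
  (2 * (\sum_(p in Q) #|pencil A p|) <=
   2 * #|\bigcup_(p in Q) pencil A p| + #|Q| * #|Q|.-1)%N.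
Proof.
elim/finset_ind: Q => [|q Q qQ IH]; first by rewrite !big_set0.
rewrite !big_setU1 //= cardsU1 qQ /=.
set U := \bigcup_(p in Q) pencil A p in IH *.
have cardI : (#|pencil A q :&: U| <= #|Q|)%N.
  rewrite /U big_distrr /=; apply: leq_trans (leq_card_bigcup _ _) _.
  rewrite -sum1_card; apply: leq_sum => p pQ.
  by apply: card_pencilI_le1; apply: contraNneq qQ => ->.
have := cardsUI (pencil A q) U.
by move: IH cardI; case: #|Q| => [|k] /=; nia.
Qed.

Lemma card_rich_le_sqr S Q :
  {in Q, forall p, (1 < #|pencil S p|)%N} -> (#|Q| <= #|S| ^ 2)%N.
Proof.
move=> richQ.
have [->|[p0 /richQ/card_gt1P[l0 _]]] := set_0Vmem Q; first by rewrite cards0.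
have two_lines p : exists lm : LT * LT, p \in Q ->
    [/\ lm.1 \in pencil S p, lm.2 \in pencil S p & lm.1 != lm.2].
  have [/richQ/card_gt1P[l [m [? ? ?]]]|_] := boolP (p \in Q); last by exists (l0, l0).
  by exists (l, m).
have [f fP] := fin_all_exists two_lines.
have f_inj : {in Q &, injective f}.
  move=> p q pQ qQ fpq; apply/eqP/negP => /negP npq.
  have [] := fP _ pQ; have [] := fP _ qQ; rewrite fpq !inE.
  move=> /andP[_ q1] /andP[_ q2] ne /andP[_ p1] /andP[_ p2] _.
  by move: ne; rewrite (linear_inc npq p1 q1 p2 q2) eqxx.
rewrite -(card_in_imset f_inj) -mulnn -cardsX subset_leq_card //.
apply/subsetP => _ /imsetP[p pQ ->]; rewrite inE.
by have [] := fP _ pQ; rewrite !inE => /andP[-> _] /andP[-> _].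
Qed.

Section RichPoints.
Variables (R : realFieldType) (S : {set LT}) (d : R).
Hypothesis d_gt0 : 0 < d.

Lemma card_bigcup_few_pencils_ge Q : #|Q|%:R <= d / 2 + 1 ->
  {in Q, forall p, d <= #|pencil S p|%:R} ->
  3 / 4 * (#|Q|%:R * d) <= #|\bigcup_(p in Q) pencil S p|%:R.
Proof.
move=> fewQ richQ; have := sum_card_pencil_le S Q.
rewrite -(ler_nat R) natrD !natrM natr_sum.
have : #|Q|%:R * d <= \sum_(p in Q) #|pencil S p|%:R.
  by rewrite mulr_natl -sumr_const; apply: ler_sum => p; exact: richQ.
have : #|Q|%:R * #|Q|.-1%:R <= #|Q|%:R * (d / 2).
  rewrite ler_wpM2l //; case: #|Q| fewQ => [|k] /=; last by rewrite -natr1; lra.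
  by move=> _; rewrite divr_ge0 // ltW.
lra.
Qed.

Lemma card_bigcup_many_pencils_ge Q : d / 2 <= #|Q|%:R ->
  {in Q, forall p, d <= #|pencil S p|%:R} ->
  3 / 8 * d ^+ 2 <= #|\bigcup_(p in Q) pencil S p|%:R.
Proof.
move=> manyQ richQ; have d2_ge0 : 0 <= d / 2 by rewrite divr_ge0 // ltW.
have [Q' [sQ' manyQ' fewQ']] := exists_subset_ceil d2_ge0 manyQ.
have sU : \bigcup_(p in Q') pencil S p \subset \bigcup_(p in Q) pencil S p.
  by apply/bigcupsP => p pQ'; rewrite bigcup_sup // (subsetP sQ').
have richQ' p : p \in Q' -> d <= #|pencil S p|%:R.
  by move=> pQ'; apply: richQ; apply: (subsetP sQ').
apply: le_trans (_ : #|\bigcup_(p in Q') pencil S p|%:R <= _); last first.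
  by rewrite ler_nat subset_leq_card.
apply: le_trans (card_bigcup_few_pencils_ge fewQ' richQ'); nra.
Qed.

Lemma card_very_rich_le Q : 4 * #|S|%:R <= d ^+ 2 ->
  {in Q, forall p, d <= #|pencil S p|%:R} -> #|Q|%:R * d <= 2 * #|S|%:R.
Proof.
move=> dS richQ.
have : #|\bigcup_(p in Q) pencil S p|%:R <= #|S|%:R :> R.
  by rewrite ler_nat subset_leq_card //; apply/bigcupsP => p _; exact: pencil_subset.
have d2_gt0 : 0 < d ^+ 2 by rewrite exprn_gt0.
have [manyQ|fewQ] := lerP (d / 2) #|Q|%:R.
  by have := card_bigcup_many_pencils_ge manyQ richQ; lra.
by have := card_bigcup_few_pencils_ge _ richQ; have := ler0n R #|S|; lra.
Qed.

End RichPoints.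

Lemma sum_very_rich_le S Q : {in Q, forall p, (4 * #|S| <= #|pencil S p| ^ 2)%N} ->
  (\sum_(p in Q) #|pencil S p| <= 2 * #|S|)%N.
Proof.
move=> richQ; have [->|[p0 p0Q]] := set_0Vmem Q; first by rewrite big_set0.
have sum_le := sum_card_pencil_le S Q.
have leU : (#|\bigcup_(p in Q) pencil S p| <= #|S|)%N.
  by rewrite subset_leq_card //; apply/bigcupsP => p _; exact: pencil_subset.
have [S0|S_gt0] := posnP #|S|.
  by rewrite big1 // => p _; have := subset_leq_card (pencil_subset S p); rewrite S0; lia.
suff cardQ : (#|Q| * #|Q|.-1 <= #|S|)%N by lia.
have [p pQ pmin] := arg_minnP (fun p => #|pencil S p|) p0Q.
have := richQ p pQ; set k := #|pencil S p| in pmin * => leSk.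
have k_gt0 : (0 < k)%N by rewrite lt0n; apply: contraTneq leSk => ->; lia.
have : (#|Q| * k <= 2 * #|S|)%N.
  rewrite -(ler_nat rat) !natrM; apply: card_very_rich_le; first by rewrite ltr0n.
    by rewrite -natrX -natrM ler_nat.
  by move=> q qQ; rewrite ler_nat pmin.
move: leSk (leq_pred #|Q|); move: #|S| #|Q| #|Q|.-1 => s q q'; nia.
Qed.

End PartialLinearSpace.

(** * Points and lines in the complex plane *)

Section SquaredNorm.
Variable R : rcfType.
Implicit Types z w : R[i].

Definition sqnorm z : R := complex.Re z ^+ 2 + complex.Im z ^+ 2.

Lemma sqnorm_ge0 z : 0 <= sqnorm z.
Proof. by rewrite addr_ge0 ?sqr_ge0. Qed.

Lemma sqnorm0 : sqnorm 0 = 0.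
Proof. by rewrite /sqnorm /= expr0n addr0. Qed.

Lemma sqnorm_eq0 z : (sqnorm z == 0) = (z == 0).
Proof.
rewrite /sqnorm paddr_eq0 ?sqr_ge0 // !sqrf_eq0.
by case: z => a b; rewrite eq_complex /=.
Qed.

Lemma sqnorm_gt0 z : (0 < sqnorm z) = (z != 0).
Proof. by rewrite lt0r sqnorm_eq0 sqnorm_ge0 andbT. Qed.

Lemma sqnormM z w : sqnorm (z * w) = sqnorm z * sqnorm w.
Proof. by case: z w => [a b] [c d]; rewrite /sqnorm /=; ring. Qed.

Lemma sqnormBC z w : sqnorm (z - w) = sqnorm (w - z).
Proof. by case: z w => [a b] [c d]; rewrite /sqnorm /=; ring. Qed.

Lemma sqnormB_le z w : sqnorm (z - w) <= 2 * sqnorm z + 2 * sqnorm w.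
Proof.
case: z w => [a b] [c d]; rewrite /sqnorm /=.
by have := sqr_ge0 (a + c); have := sqr_ge0 (b + d); lra.
Qed.

Lemma sqnormB_ge z w : sqnorm z / 2 - sqnorm w <= sqnorm (z - w).
Proof.
case: z w => [a b] [c d]; rewrite /sqnorm /=.
by have := sqr_ge0 (a - 2 * c); have := sqr_ge0 (b - 2 * d); lra.
Qed.

Definition octant z : bool * bool * bool :=
  (0 <= complex.Re z, 0 <= complex.Im z,
   complex.Re z ^+ 2 <= complex.Im z ^+ 2).

(* The directions of [z] and [w] differ by at most 45 degrees; 60 would do. *)
Lemma octant_dot_ge z w : octant z = octant w -> sqnorm z <= sqnorm w ->
  sqnorm z <= 2 * (complex.Re z * complex.Re w + complex.Im z * complex.Im w).
Proof.
case: z w => [a b] [c d]; rewrite /octant /sqnorm /= => -[sgRe sgIm cmp] lezw.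
have ac_ge0 : 0 <= a * c.
  by case: (lerP 0 a) sgRe => a0; case: (lerP 0 c) => c0 // _; nra.
have bd_ge0 : 0 <= b * d.
  by case: (lerP 0 b) sgIm => b0; case: (lerP 0 d) => d0 // _; nra.
have acE : (a * c) ^+ 2 = a ^+ 2 * c ^+ 2 by ring.
have bdE : (b * d) ^+ 2 = b ^+ 2 * d ^+ 2 by ring.
have := sqr_ge0 a; have := sqr_ge0 b; have := sqr_ge0 c; have := sqr_ge0 d.
move: (a ^+ 2) (b ^+ 2) (c ^+ 2) (d ^+ 2) (a * c) (b * d) => A B C D u v in
  ac_ge0 bd_ge0 acE bdE lezw cmp *; move=> D0 C0 B0 A0.
rewrite -ler_sqr ?nnegrE ?addr_ge0 ?mulr_ge0 ?addr_ge0 //.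
have -> : (2 * (u + v)) ^+ 2 = 4 * (u ^+ 2 + v ^+ 2 + 2 * (u * v)) by ring.
have uv_ge0 : 0 <= u * v by exact: mulr_ge0.
rewrite acE bdE; suff : (A + B) ^+ 2 <= 4 * (A * C + B * D) by lra.
by move: cmp; case: (lerP A B) => AB; case: (lerP C D) => CD // _; nra.
Qed.

Lemma sqnormB_octant_le z w :
  octant z = octant w -> sqnorm z <= sqnorm w -> sqnorm (w - z) <= sqnorm w.
Proof.
move=> ozw lezw; have := octant_dot_ge ozw lezw.
by case: z w {ozw lezw} => [a b] [c d]; rewrite /sqnorm /=; lra.
Qed.

End SquaredNorm.

Section Coordinates.
Variables (F : fieldType) (PT LT : finType).
Variables (x y : PT -> F) (s t : LT -> F).
Hypothesis points_inj : injective (fun p => (x p, y p)).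
Implicit Types (p q : PT) (l m : LT).

Definition incident p l : bool := y p == s l * x p + t l.

Lemma incident_inj l p q : incident p l -> incident q l -> x p = x q -> p = q.
Proof.
by move=> /eqP yp /eqP yq xpq; apply: points_inj; rewrite /= yp yq xpq.
Qed.

Lemma incident_linear :
  injective (fun l => (s l, t l)) -> partial_linear_space incident.
Proof.
move=> lines_inj p q l m npq pl ql pm qm.
have nx : x p - x q != 0.
  by rewrite subr_eq0; apply: contra npq => /eqP /(incident_inj pl ql) ->.
have slope l' : incident p l' -> incident q l' -> s l' = (y p - y q) / (x p - x q).
  by move=> /eqP -> /eqP ->; field.
have sE : s l = s m by rewrite !slope.
apply: lines_inj; rewrite /= sE; congr (_, _).
by move: pl pm; rewrite /incident sE => /eqP -> /eqP /addrI.
Qed.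

Definition cross_abscissa l m : F := (t m - t l) / (s l - s m).

Lemma cross_abscissa_diff p q l k m : s l != s m ->
  incident p l -> incident p k -> incident q k -> incident q m ->
  (cross_abscissa l m - x p) * (s l - s m) = (x q - x p) * (s k - s m).
Proof.
rewrite -subr_eq0 => nlm /eqP pl /eqP pk /eqP qk /eqP qm.
rewrite mulrBl divfK //.
have -> : t m = y q - s m * x q by rewrite qm; ring.
have -> : t l = y p - s l * x p by rewrite pl; ring.
have -> : y q = y p + s k * (x q - x p) by rewrite pk qk; ring.
by ring.
Qed.

End Coordinates.

Section TransversalFamilies.
Variables (R : rcfType) (PT LT : finType).
Variables (x y : PT -> R[i]) (s t : LT -> R[i]).
Hypothesis points_inj : injective (fun p => (x p, y p)).
Hypothesis lines_inj : injective (fun l => (s l, t l)).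
Implicit Types (A B : {set LT}) (p q : PT) (l m b v : LT).

Local Notation inc := (incident x y s t).
Local Notation pencil := (pencil inc).
Local Notation cross_abscissa := (cross_abscissa s t).

Variables (Q : {set PT}) (d : R).
Hypothesis d_gt0 : 0 < d.

Definition other_points p l : pred PT := [pred q | [&& q \in Q, q != p & inc q l]].

(* The lines of [B] meeting [l] inside the largest open disc of [l] centred at
   [p] that contains no other point of [Q]. *)
Definition cap B p l : {set LT} :=
  [set b in B | [forall (q | q \in other_points p l),
                   sqnorm (cross_abscissa l b - x p) < sqnorm (x q - x p)]].

Lemma capP B p l b q : b \in cap B p l -> q \in other_points p l ->
  sqnorm (cross_abscissa l b - x p) < sqnorm (x q - x p).
Proof. by rewrite inE => /andP[_ /forall_inP]; apply. Qed.

(* Planar discs none of which contains the centre of another one overlap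
   boundedly often. *)
Lemma cap_overlap B l b :
  (#|[set p in Q | inc p l & b \in cap B p l]| <= 8)%N.
Proof.
set E := finset _; pose f p := octant (x p - cross_abscissa l b).
suff closer p q : p \in E -> q \in E -> f p = f q ->
    sqnorm (x p - cross_abscissa l b) <= sqnorm (x q - cross_abscissa l b) -> p = q.
  have f_inj : {in E &, injective f}.
    move=> p q pE qE fpq.
    have [|/ltW] :=
        lerP (sqnorm (x p - cross_abscissa l b)) (sqnorm (x q - cross_abscissa l b)).
      exact: closer.
    by move=> ?; apply/esym; apply: closer.
  rewrite -(card_in_imset f_inj); apply: leq_trans (max_card _) _.
  by rewrite !card_prod card_bool.
rewrite inE => /and3P[pQ pl _]; rewrite inE => /and3P[_ _ qb] fpq lepq.
apply/eqP/negP => /negP npq.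
have := capP qb (_ : p \in other_points q l); rewrite inE pQ npq pl => /(_ isT).
rewrite ltNge sqnormBC [leRHS]sqnormBC.
have -> : x q - x p = (x q - cross_abscissa l b) - (x p - cross_abscissa l b) by ring.
by rewrite sqnormB_octant_le.
Qed.

Lemma sum_cap_le A B :
  (\sum_(p in Q) \sum_(l in pencil A p) #|cap B p l| <= 8 * (#|A| * #|B|))%N.
Proof.
under eq_bigr => p _ do under eq_bigr => l _ do rewrite -sum1_card.
rewrite (exchange_big_dep (mem A)) /= => [|p l _]; last by rewrite inE => /andP[].
rewrite mulnC -mulnA -sum_nat_const; apply: leq_sum => l lA.
rewrite (exchange_big_dep (mem B)) /= => [|p b _]; last by rewrite inE => /andP[].
rewrite -sum_nat_const; apply: leq_sum => b _.
rewrite sum1dep_card; apply: leq_trans (cap_overlap B l b).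
by apply/subset_leq_card/subsetP => p; rewrite !inE lA -andbA.
Qed.

Definition well_crossed A B p : {set LT} :=
  [set l in pencil A p | d ^+ 2 / 4 <= #|cap B p l|%:R].

Lemma sum_well_crossed_le A B :
  (\sum_(p in Q) #|well_crossed A B p|%:R) * (d ^+ 2 / 4) <= 8 * (#|A|%:R * #|B|%:R).
Proof.
have := sum_cap_le A B; rewrite -(ler_nat R) !natrM; apply: le_trans.
rewrite natr_sum mulr_suml; apply: ler_sum => p _.
rewrite natr_sum (big_setID (well_crossed A B p)) /= -[leLHS]addr0.
apply: lerD; last exact: sumr_ge0.
rewrite mulr_natl -sumr_const (setIidPr _); last by apply/subsetP => l /setIdP[].
by apply: ler_sum => l /setIdP[].
Qed.

Definition poorly_crossed A B p : {set LT} := pencil A p :\: well_crossed A B p.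

Lemma mem_poorly_crossed A B p l : (l \in poorly_crossed A B p) =
  [&& l \in A, inc p l & #|cap B p l|%:R < d ^+ 2 / 4].
Proof.
by rewrite !inE ltNge; case: (l \in A); case: (inc p l); rewrite ?andbF ?andbT.
Qed.

Lemma card_poorly_crossed_ge A B p :
  #|well_crossed A B p|%:R < d / 2 -> d <= #|pencil A p|%:R ->
  d / 2 <= #|poorly_crossed A B p|%:R.
Proof.
have sS : well_crossed A B p \subset pencil A p by apply/subsetP => l /setIdP[].
by rewrite cardsD (setIidPr sS) natrB ?subset_leq_card //; lra.
Qed.

Definition nearest p l : PT :=
  if [pick q in other_points p l] is Some q0
  then [arg min_(q < q0 | q \in other_points p l) sqnorm (x q - x p)]%O else p.

Definition gap p l : R := sqnorm (x (nearest p l) - x p).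

Lemma gap_gt0 p l : inc p l -> nearest p l \in other_points p l -> 0 < gap p l.
Proof.
move=> pl /and3P[_ nqp ql]; rewrite sqnorm_gt0 subr_eq0.
by apply: contra nqp => /eqP /(incident_inj points_inj ql pl) ->.
Qed.

Lemma poorly_crossed_nearest A B p l :
  d ^+ 2 <= 4 * #|B|%:R -> l \in poorly_crossed A B p ->
  nearest p l \in other_points p l /\
  {in B, forall b, sqnorm (cross_abscissa l b - x p) < gap p l -> b \in cap B p l}.
Proof.
move=> B_large; rewrite mem_poorly_crossed => /and3P[_ _ cap_small].
rewrite /gap /nearest; case: pickP => [q0 q0P|no_other_points]; last first.
  suff capE : cap B p l = B by move: cap_small; rewrite capE; lra.
  apply/setP => b; rewrite inE; case: (b \in B) => //=.
  by apply/forall_inP => q; rewrite no_other_points.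
case: arg_minP => // q qP qmin; split=> // b bB close; rewrite inE bB /=.
by apply/forall_inP => q' /qmin; apply: lt_le_trans close.
Qed.

(* The lines of [A] through the neighbours of [p] on its poorly crossed [A]-lines
   are too many to meet a poorly crossed [B]-line [v] all close to [p]. *)
Lemma poorly_crossed_far_crossing A B p v :
  {in Q, forall q, d <= #|pencil A q|%:R} ->
  d ^+ 2 <= 4 * #|A|%:R -> d ^+ 2 <= 4 * #|B|%:R ->
  d / 2 <= #|poorly_crossed A B p|%:R -> v \in poorly_crossed B A p ->
  exists l h, [/\ l \in poorly_crossed A B p, h \in A, inc (nearest p l) h &
    gap p v <= sqnorm (cross_abscissa v h - x p)].
Proof.
move=> richA A_large B_large many_poor vC.
have nearest_inj : {in poorly_crossed A B p &, injective (nearest p)}.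
  move=> l m lC mC nlm.
  have [/and3P[_ npl nl] _] := poorly_crossed_nearest B_large lC.
  have [/and3P[_ _ nm] _] := poorly_crossed_nearest B_large mC.
  move: lC mC; rewrite !mem_poorly_crossed => /and3P[_ pl _] /and3P[_ pm _].
  rewrite -nlm in nm.
  exact: (incident_linear points_inj lines_inj npl nl pl nm pm).
pose N := [set nearest p l | l in poorly_crossed A B p].
have many_lines : 3 / 8 * d ^+ 2 <= #|\bigcup_(q in N) pencil A q|%:R.
  apply: (card_bigcup_many_pencils_ge (incident_linear points_inj lines_inj)) => //.
    by rewrite card_in_imset.
  move=> q /imsetP[l lC ->]; apply: richA.
  by have [/and3P[]] := poorly_crossed_nearest B_large lC.
have [vB pv cap_small] := and3P (etrans (esym (mem_poorly_crossed _ _ _ _)) vC).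
have /subsetPn[h /bigcupP[q /imsetP[l lC ->] hq] h_far] :
    ~~ (\bigcup_(q in N) pencil A q \subset cap A p v).
  apply/negP => /subset_leq_card; rewrite -(ler_nat R).
  by have := exprn_gt0 2 d_gt0; lra.
move: hq => /setIdP[hA hq]; exists l, h; split=> //.
rewrite leNgt; apply: contra h_far.
by have [_] := poorly_crossed_nearest A_large vC; apply.
Qed.

Section TwoDirections.
Variables (A B : {set LT}) (z0 : R[i]) (r : R) (p : PT).
Hypothesis r_gt0 : 0 < r.
Hypothesis near_slopes : {in A, forall l, sqnorm (s l - z0) <= r}.
Hypothesis far_slopes : {in B, forall l, 100 * r <= sqnorm (s l - z0)}.
Hypothesis A_large : d ^+ 2 <= 4 * #|A|%:R.
Hypothesis B_large : d ^+ 2 <= 4 * #|B|%:R.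
Hypothesis richA : {in Q, forall q, d <= #|pencil A q|%:R}.
Hypothesis richB : {in Q, forall q, d <= #|pencil B q|%:R}.

Local Notation slope_dist l := (sqnorm (s l - z0)).

Lemma slope_diff_ge l m : l \in A -> m \in B ->
  49 / 100 * slope_dist m <= sqnorm (s m - s l).
Proof.
move=> /near_slopes l_near /far_slopes m_far.
have -> : s m - s l = (s m - z0) - (s l - z0) by ring.
by apply: le_trans (sqnormB_ge _ _); lra.
Qed.

Lemma slope_diff_le l m : sqnorm (s l - s m) <= 2 * slope_dist l + 2 * slope_dist m.
Proof.
have -> : s l - s m = (s l - z0) - (s m - z0) by ring.
exact: sqnormB_le.
Qed.

Lemma slope_neq l m : l \in A -> m \in B -> s m != s l.
Proof.
move=> lA mB; rewrite -subr_eq0 -sqnorm_gt0.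
apply: lt_le_trans (slope_diff_ge lA mB).
by move: r_gt0 (far_slopes mB); lra.
Qed.

Lemma far_gap_le (T : R) v :
  v \in poorly_crossed B A p -> d / 2 <= #|poorly_crossed A B p|%:R ->
  {in poorly_crossed A B p, forall l, gap p l <= T} ->
  49 * (slope_dist v * gap p v) <= 400 * (r * T).
Proof.
move=> vC many_poor gap_le.
have [l [h [lC hA qh far]]] :=
  poorly_crossed_far_crossing richA A_large B_large many_poor vC.
have gap_ge0 k : 0 <= gap p k by exact: sqnorm_ge0.
move: (lC) (vC); rewrite !mem_poorly_crossed => /and3P[lA pl _] /and3P[vB pv _].
have [/and3P[_ _ ql] _] := poorly_crossed_nearest B_large lC.
have /(congr1 (@sqnorm R)) := cross_abscissa_diff (slope_neq hA vB) pv pl ql qh.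
rewrite !sqnormM -/(gap p l) => crossE.
have lower : 49 / 100 * slope_dist v * gap p v <=
    sqnorm (cross_abscissa v h - x p) * sqnorm (s v - s h).
  rewrite mulrC; apply: ler_pM (gap_ge0 v) _ far (slope_diff_ge hA vB).
  by rewrite !mulr_ge0 ?invr_ge0 ?sqnorm_ge0.
have upper : gap p l * sqnorm (s l - s h) <= T * (4 * r).
  apply: ler_pM; rewrite ?sqnorm_ge0 ?gap_le //.
  by have := slope_diff_le l h; have := near_slopes lA; have := near_slopes hA; lra.
by move: lower upper; rewrite crossE; lra.
Qed.

Lemma near_gap_le (M : R) l :
  l \in poorly_crossed A B p -> d / 2 <= #|poorly_crossed B A p|%:R ->
  {in poorly_crossed B A p, forall v, slope_dist v * gap p v <= M} ->
  49 * (r * gap p l) <= 4 * M.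
Proof.
move=> lC many_poor gap_le.
have [v [b [vC bB qb far]]] :=
  poorly_crossed_far_crossing richB B_large A_large many_poor lC.
move: (lC) (vC); rewrite !mem_poorly_crossed => /and3P[lA pl _] /and3P[vB pv _].
have [/and3P[_ _ qv] _] := poorly_crossed_nearest A_large vC.
have nlb : s l != s b by rewrite eq_sym slope_neq.
have /(congr1 (@sqnorm R)) := cross_abscissa_diff nlb pl pv qv qb.
rewrite !sqnormM -/(gap p v) [in X in X = _](sqnormBC (s l)) => crossE.
have gapv_ge0 : 0 <= gap p v by exact: sqnorm_ge0.
have v_far := far_slopes vB; have b_far := far_slopes bB.
have lower : gap p l * (49 / 100 * slope_dist b) <=
    sqnorm (cross_abscissa l b - x p) * sqnorm (s b - s l).
  apply: ler_pM; rewrite ?sqnorm_ge0 ?slope_diff_ge //.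
  by rewrite !mulr_ge0 ?invr_ge0 ?sqnorm_ge0.
have upper : gap p v * sqnorm (s v - s b) <=
    gap p v * (2 * slope_dist v + 2 * slope_dist b).
  by rewrite ler_wpM2l // slope_diff_le.
have gapv_le := gap_le v vC.
have b_gt0 : 0 < slope_dist b by move: r_gt0; lra.
rewrite -(ler_pM2r b_gt0).
have r_gap : 100 * r * gap p v <= M.
  by apply: le_trans gapv_le; rewrite ler_wpM2r.
have M_ge0 : 0 <= M by apply: le_trans gapv_le; rewrite mulr_ge0 ?sqnorm_ge0.
have rM_le : 100 * r * M <= slope_dist b * M by rewrite ler_wpM2r.
have bgap_le : slope_dist b * (100 * r * gap p v) <= slope_dist b * M.
  by rewrite ler_wpM2l // ltW.
rewrite -crossE in upper; have := ler_wpM2l (ltW r_gt0) (le_trans lower upper).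
by have := ler_wpM2l (ltW r_gt0) gapv_le; lra.
Qed.

Lemma well_crossed_or : p \in Q ->
  d / 2 <= #|well_crossed A B p|%:R \/ d / 2 <= #|well_crossed B A p|%:R.
Proof.
move=> pQ.
have [|few_wellA] := lerP (d / 2) #|well_crossed A B p|%:R; first by left.
have [|few_wellB] := lerP (d / 2) #|well_crossed B A p|%:R; first by right.
have many_poorA := card_poorly_crossed_ge few_wellA (richA pQ).
have many_poorB := card_poorly_crossed_ge few_wellB (richB pQ).
have nonempty (C : {set LT}) : d / 2 <= #|C|%:R -> exists l, l \in C.
  move=> C_large; apply/card_gt0P; rewrite -(ltr_nat R).
  by apply: lt_le_trans C_large; rewrite divr_gt0.
have [[l0 l0C] [v0 v0C]] := (nonempty _ many_poorA, nonempty _ many_poorB).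
case: (arg_maxP (gap p) l0C) => l lC /= lmax.
case: (arg_maxP (fun v => slope_dist v * gap p v) v0C) => v vC /= vmax.
have := far_gap_le vC many_poorA lmax; have := near_gap_le lC many_poorB vmax.
have [lother _] := poorly_crossed_nearest B_large lC.
have : 0 < r * gap p l.
  rewrite mulr_gt0 // gap_gt0 //.
  by have /setDP[/setIdP[]] := lC.
by lra.
Qed.

End TwoDirections.

Lemma card_two_directions_le A B (z0 : R[i]) (r : R) : 0 < r ->
  {in A, forall l, sqnorm (s l - z0) <= r} ->
  {in B, forall l, 100 * r <= sqnorm (s l - z0)} ->
  d ^+ 2 <= 4 * #|A|%:R -> d ^+ 2 <= 4 * #|B|%:R ->
  {in Q, forall q, d <= #|pencil A q|%:R} ->
  {in Q, forall q, d <= #|pencil B q|%:R} ->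
  #|Q|%:R * d ^+ 3 <= 128 * (#|A|%:R * #|B|%:R).
Proof.
move=> r_gt0 nearA farB A_large B_large richA richB.
have sum_ge : #|Q|%:R * (d / 2) <=
    \sum_(p in Q) #|well_crossed A B p|%:R + \sum_(p in Q) #|well_crossed B A p|%:R.
  rewrite -big_split /= mulr_natl -sumr_const; apply: ler_sum => p pQ.
  have [?|?] := well_crossed_or r_gt0 nearA farB A_large B_large richA richB pQ.
    by rewrite ler_wpDr.
  by rewrite ler_wpDl.
have := sum_well_crossed_le A B; have := sum_well_crossed_le B A.
rewrite (mulrC #|B|%:R).
have d2_gt0 : 0 < d ^+ 2 / 4 by rewrite divr_gt0 ?exprn_gt0.
move: sum_ge; rewrite -(ler_pM2r d2_gt0) mulrDl.
have -> : #|Q|%:R * d ^+ 3 = 8 * (#|Q|%:R * (d / 2) * (d ^+ 2 / 4)) by field.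
by lra.
Qed.

End TransversalFamilies.

Section DenseDisc.
Variables (R : archiRcfType) (T : finType) (s : T -> R[i]).
Implicit Types (S : {set T}).

Lemma normr_Re_Im_lt (z : R[i]) (r : R) : 0 <= r -> sqnorm z < r ^+ 2 ->
  `|complex.Re z| < r /\ `|complex.Im z| < r.
Proof.
case: z => a b; rewrite /sqnorm /= => r_ge0 ltzr.
have a2_ge0 := sqr_ge0 a; have b2_ge0 := sqr_ge0 b.
by split; rewrite -(ltr_sqr (normr_ge0 _) r_ge0) real_normK ?num_real //; lra.
Qed.

Lemma truncn_eq_close (u v : R) :
  0 <= u -> 0 <= v -> Num.truncn u = Num.truncn v -> `|u - v| <= 1.
Proof.
move=> /truncn_itv/andP[u1 u2] /truncn_itv/andP[v1 v2] uv.
rewrite -uv -natr1 in v1 v2; rewrite -natr1 in u2.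
by rewrite ler_norml; apply/andP; split; lra.
Qed.

Lemma exists_interval_cells n (h : R) : 0 < h ->
  exists cell : R -> 'I_n.+1, forall a b,
    `|a| < h -> `|b| < h -> cell a = cell b -> `|a - b| <= 2 * h / n.+1%:R.
Proof.
move=> h_gt0; pose c : R := n.+1%:R / (2 * h).
have c_gt0 : 0 < c by rewrite divr_gt0 ?mulr_gt0.
have bound a : `|a| < h -> 0 <= (a + h) * c /\ (a + h) * c < n.+1%:R.
  rewrite ltr_norml => /andP[lo hi]; split; first by rewrite mulr_ge0 ?ltW //; lra.
  have -> : n.+1%:R = 2 * h * c by rewrite /c; field; rewrite gt_eqF.
  by rewrite ltr_pM2r //; lra.
exists (fun a => inord (Num.truncn ((a + h) * c))) => a b /bound[a0 an] /bound[b0 bn].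
move=> /(congr1 (@nat_of_ord _)); rewrite !inordK ?truncn_lt_nat //.
move=> /(truncn_eq_close a0 b0).
have -> : (a + h) * c - (b + h) * c = (a - b) * c by ring.
rewrite normrM [`|c|]gtr0_norm // -ler_pdivlMr // mul1r.
by rewrite /c invf_div.
Qed.

(* [r] is the square of the radius. *)
Definition disc S z r : {set T} := [set k in S | sqnorm (s k - z) <= r].

Lemma disc_radius_attained S l r : l \in S -> 0 <= r ->
  exists2 m, m \in disc S (s l) r & disc S (s l) (sqnorm (s m - s l)) = disc S (s l) r.
Proof.
move=> lS r_ge0; have l_disc : l \in disc S (s l) r by rewrite inE lS subrr sqnorm0.
case: (arg_maxP (fun m => sqnorm (s m - s l)) l_disc) => m mD mmax.
exists m => //; apply/setP => k; rewrite !inE; case kS: (k \in S) => //=.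
apply/idP/idP => [lekm|ler]; last by apply: mmax; apply/setIdP.
by have /setIdP[_] := mD; apply: le_trans.
Qed.

Lemma exists_smallest_disc S (w : R) : 0 < w -> w <= #|S|%:R ->
  exists l r, [/\ 0 <= r, w <= #|disc S (s l) r|%:R &
    {in S, forall k r', 0 <= r' -> r' < r -> #|disc S (s k) r'|%:R < w}].
Proof.
move=> w_gt0 wS.
pose heavy (lm : T * T) := [&& lm.1 \in S, lm.2 \in S &
  w <= #|disc S (s lm.1) (sqnorm (s lm.2 - s lm.1))|%:R].
have [lm lm_heavy] : exists lm, heavy lm.
  have [l lS] : exists l, l \in S.
    by apply/card_gt0P; rewrite -(ltr_nat R); apply: lt_le_trans wS.
  case: (arg_maxP (fun m => sqnorm (s m - s l)) lS) => m mS mmax.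
  exists (l, m); apply/and3P; split=> //=; apply: le_trans wS _.
  rewrite ler_nat subset_leq_card //; apply/subsetP => k kS.
  by apply/setIdP; split; last exact: mmax.
case: (arg_minP (fun lm => sqnorm (s lm.2 - s lm.1)) lm_heavy) => -[l m].
move=> /and3P[/= lS mS lm_ge] lm_min; exists l, (sqnorm (s m - s l)); split=> //.
  exact: sqnorm_ge0.
move=> k kS r' r'_ge0 lt_r'; rewrite ltNge; apply/negP => k_ge.
have [k' /setIdP[k'S lek'] discE] := disc_radius_attained kS r'_ge0.
have /lm_min : heavy (k, k') by rewrite /heavy /= kS k'S discE.
by rewrite /= leNgt (le_lt_trans lek').
Qed.

(* A disc of ten times the radius is covered by a grid of 1600 squares, each
   inside a disc around any of its points. *)
Lemma card_tenfold_disc_le S z (r w : R) : 0 < r -> 0 <= w ->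
  {in S, forall k, #|disc S (s k) (r / 2)|%:R <= w} ->
  #|[set k in S | sqnorm (s k - z) < 100 * r]|%:R <= 1600 * w.
Proof.
move=> r_gt0 w_ge0 disc_le; pose rho := Num.sqrt r.
have rho_gt0 : 0 < rho by rewrite sqrtr_gt0.
have rho2 : rho ^+ 2 = r by rewrite sqr_sqrtr ?ltW.
have h_gt0 : 0 < 10 * rho by rewrite mulr_gt0.
have [cell cellP] := exists_interval_cells 39 h_gt0.
have cell_close a b : `|a| < 10 * rho -> `|b| < 10 * rho -> cell a = cell b ->
    (a - b) ^+ 2 <= r / 4.
  move=> a_lt b_lt /(cellP _ _ a_lt b_lt) close.
  rewrite -real_normK ?num_real // -rho2.
  have -> : rho ^+ 2 / 4 = (2 * (10 * rho) / 40) ^+ 2 by field.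
  by rewrite ler_sqr ?nnegrE // (le_trans _ close).
pose square k := (cell (complex.Re (s k - z)), cell (complex.Im (s k - z))).
set D := finset _.
have -> : #|D| = (\sum_(c : 'I_40 * 'I_40) #|[set k in D | square k == c]|)%N.
  rewrite -sum1_card (partition_big square predT) //=.
  by apply: eq_bigr => c _; rewrite sum1dep_card.
have -> : 1600 * w = \sum_(c : 'I_40 * 'I_40) w.
  by rewrite sumr_const card_prod !card_ord -[RHS]mulr_natl natrM; ring.
rewrite natr_sum; apply: ler_sum => c _.
have [->|[k /setIdP[/setIdP[kS kD] /eqP kc]]] := set_0Vmem [set k in D | square k == c].
  by rewrite cards0.
apply: le_trans (disc_le k kS); rewrite ler_nat subset_leq_card //.
apply/subsetP => j /setIdP[/setIdP[jS jD] /eqP jc]; rewrite inE jS /=.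
have in_box i : sqnorm (s i - z) < 100 * r ->
    `|complex.Re (s i - z)| < 10 * rho /\ `|complex.Im (s i - z)| < 10 * rho.
  by move=> iD; apply: normr_Re_Im_lt; [exact: ltW | rewrite exprMn rho2; lra].
have [kRe kIm] := in_box _ kD; have [jRe jIm] := in_box _ jD.
move: jc; rewrite -kc => -[/(cell_close _ _ jRe kRe) + /(cell_close _ _ jIm kIm)].
have -> : s j - s k = (s j - z) - (s k - z) by ring.
by case: (s j - z) (s k - z) => [a b] [a' b']; rewrite /sqnorm /=; lra.
Qed.

Lemma exists_dense_disc S (w : R) : 0 < w -> w <= #|S|%:R ->
  exists z r, [/\ 0 <= r, w <= #|disc S z r|%:R &
    #|[set k in S | sqnorm (s k - z) < 100 * r]|%:R <= 1600 * w].
Proof.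
move=> w_gt0 wS; have [l [r [r_ge0 dense smallest]]] := exists_smallest_disc w_gt0 wS.
exists (s l), r; split=> //; move: r_ge0; rewrite le_eqVlt => /orP[/eqP <-|r_gt0].
  rewrite mulr0 (_ : finset _ = set0) ?cards0 ?mulr_ge0 ?ltW //.
  by apply/setP => k; rewrite !inE ltNge sqnorm_ge0 andbF.
apply: card_tenfold_disc_le (ltW w_gt0) _ => // k kS.
by apply/ltW/smallest => //; lra.
Qed.

End DenseDisc.

Section RichConstants.
Variable R : realFieldType.

(* The value gives [(1 - delta) ^+ 2 + (1600 * delta) ^+ 2 <= 1 - delta], where
   1600 is the covering constant of [exists_dense_disc]. *)
Definition delta : R := (2 * 1600 ^+ 2)^-1.
Definition kappa : R := delta / 6.
Definition rich_const : R := 2 / delta * (64 + 128 / kappa ^+ 3).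

Lemma delta_gt0 : 0 < delta.
Proof. by rewrite invr_gt0 mulr_gt0 ?exprn_gt0. Qed.

Lemma kappa_gt0 : 0 < kappa.
Proof. by rewrite divr_gt0 ?delta_gt0. Qed.

Lemma deltaE : delta = 6 * kappa.
Proof. by rewrite /kappa; field. Qed.

Lemma sqr_1600_delta : (1600 * delta) ^+ 2 = delta / 2.
Proof. by rewrite /delta; field. Qed.

Lemma delta_1600_le : 1600 * delta <= 1 / 2.
Proof.
have -> : 1600 * delta = (2 * 1600)^-1 by rewrite /delta; field.
by rewrite mul1r lef_pV2 ?posrE ?mulr_gt0 // ler_peMr // ler1n.
Qed.

Lemma delta_le_half : delta <= 1 / 2.
Proof. by have := delta_1600_le; have := delta_gt0; lra. Qed.

Lemma rich_constE : rich_const * (delta / 2) = 64 + 128 / kappa ^+ 3.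
Proof. by rewrite /rich_const; field; rewrite !gt_eqF ?kappa_gt0 ?delta_gt0. Qed.

Lemma rich_const_ge : kappa ^- 3 <= rich_const.
Proof.
have kV_gt0 : 0 < kappa ^- 3 by rewrite invr_gt0 exprn_gt0 ?kappa_gt0.
have dV_ge1 : 1 <= delta^-1.
  by rewrite invf_ge1 ?delta_gt0 //; have := delta_le_half; lra.
by rewrite /rich_const; move: (kappa ^- 3) (delta^-1) kV_gt0 dV_ge1 => u v; nra.
Qed.

Lemma rich_const_gt0 : 0 < rich_const.
Proof. by apply: lt_le_trans rich_const_ge; rewrite invr_gt0 exprn_gt0 ?kappa_gt0. Qed.

Lemma rich_bound_subfamily (X m n a d : R) :
  0 < d -> d ^+ 2 <= 4 * n -> 0 <= m -> m <= a * n -> a <= 1 -> 0 <= X ->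
  X * ((1 - kappa) * d) ^+ 3 <=
    rich_const * m ^+ 2 + 4 * (m * ((1 - kappa) * d) ^+ 2) ->
  (1 - delta / 2) * (X * d ^+ 3) <= (rich_const * a ^+ 2 + 16) * n ^+ 2.
Proof.
move=> d_gt0 dn m_ge0 le_man a_le1 X_ge0 XmP.
have C_gt0 := rich_const_gt0; have k_gt0 := kappa_gt0.
have k_le : kappa <= 1 / 12 by have := delta_le_half; rewrite deltaE; lra.
have d2_gt0 : 0 < d ^+ 2 by rewrite exprn_gt0.
have n_ge0 : 0 <= n by lra.
have m2_le : m ^+ 2 <= a ^+ 2 * n ^+ 2.
  by rewrite -exprMn ler_sqr ?nnegrE // (le_trans m_ge0).
have mn : m <= n by apply: le_trans le_man _; rewrite ler_piMl.
have sqr_degree_le : ((1 - kappa) * d) ^+ 2 <= 4 * n.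
  by apply: le_trans dn; rewrite exprMn ler_piMl ?exprn_ge0 ?ltW //; nra.
have cube_degree_ge : (1 - delta / 2) * d ^+ 3 <= ((1 - kappa) * d) ^+ 3.
  by rewrite exprMn ler_pM2r ?exprn_gt0 // deltaE; nra.
have lower := ler_wpM2l X_ge0 cube_degree_ge.
have := ler_wpM2l (ltW C_gt0) m2_le.
have := ler_pM m_ge0 (sqr_ge0 _) mn sqr_degree_le.
by rewrite mulrCA in lower; rewrite [n ^+ 2]expr2; lra.
Qed.

Lemma rich_bound_recombine (X Y Z n d : R) :
  (1 - delta / 2) * (X * d ^+ 3) <= (rich_const * (1 - delta) ^+ 2 + 16) * n ^+ 2 ->
  (1 - delta / 2) * (Y * d ^+ 3) <= (rich_const * (1600 * delta) ^+ 2 + 16) * n ^+ 2 ->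
  0 <= Z * d ^+ 3 -> Z * (kappa * d) ^+ 3 <= 128 * n ^+ 2 ->
  (X + Y + Z) * d ^+ 3 <= rich_const * n ^+ 2.
Proof.
rewrite sqr_1600_delta [(kappa * d) ^+ 3]exprMn => XP YP Z_ge0 ZP.
have [C_gt0 k_gt0] := (rich_const_gt0, kappa_gt0).
have [d_gt0 d_le] := (delta_gt0, delta_le_half).
have n2_ge0 : 0 <= n ^+ 2 := sqr_ge0 n.
have {}ZP : Z * d ^+ 3 <= 128 / kappa ^+ 3 * n ^+ 2.
  by rewrite mulrAC ler_pdivlMr ?exprn_gt0 //; lra.
have shrink_gt0 : 0 < 1 - delta / 2 by lra.
have {}ZP : (1 - delta / 2) * (Z * d ^+ 3) <= 128 / kappa ^+ 3 * n ^+ 2.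
  by apply: le_trans ZP; rewrite ler_piMl //; lra.
have CE : (rich_const * (delta / 2)) * n ^+ 2 = (64 + 128 / kappa ^+ 3) * n ^+ 2.
  by rewrite rich_constE.
have gain : rich_const * (delta ^+ 2 * n ^+ 2) <= rich_const * (delta / 2 * n ^+ 2).
  by rewrite ler_pM2l // ler_wpM2r //; nra.
rewrite -(ler_pM2l shrink_gt0) !mulrDl !mulrDr.
by move: rich_const CE gain XP YP ZP n2_ge0 => C; lra.
Qed.

End RichConstants.

Section RichPoints.
Variables (R : archiRcfType) (PT LT : finType).
Variables (x y : PT -> R[i]) (s t : LT -> R[i]).
Hypothesis points_inj : injective (fun p => (x p, y p)).
Hypothesis lines_inj : injective (fun l => (s l, t l)).
Implicit Types (A B S : {set LT}) (Q : {set PT}) (p q : PT) (l m : LT).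

Local Notation inc := (incident x y s t).
Local Notation pencil := (pencil inc).
Local Notation delta := (delta R).
Local Notation kappa := (kappa R).
Local Notation rich_const := (rich_const R).

Lemma card_pencil_parallel_le1 A z p : {in A, forall l, s l = z} ->
  (#|pencil A p| <= 1)%N.
Proof.
move=> parallel; apply/card_le1_eqP => l m /setIdP[lA pl] /setIdP[mA pm].
apply: lines_inj; rewrite /= !parallel //; congr (_, _).
by move: pl pm; rewrite /incident !parallel // => /eqP -> /eqP /addrI.
Qed.

Lemma card_rich_le_of_low_degree S Q (d : R) : 1 < d -> d <= kappa^-1 ->
  {in Q, forall p, d <= #|pencil S p|%:R} ->
  #|Q|%:R * d ^+ 3 <= rich_const * #|S|%:R ^+ 2.
Proof.
move=> d_gt1 d_le richQ; have d_ge0 : 0 <= d := ltW (lt_trans ltr01 d_gt1).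
have d3_le : d ^+ 3 <= rich_const.
  apply: le_trans (rich_const_ge R); rewrite -exprVn.
  by rewrite lerXn2r // nnegrE ltW // invr_gt0 kappa_gt0.
rewrite mulrC; apply: ler_pM => //; first by rewrite exprn_ge0.
rewrite -natrX ler_nat.
apply: (card_rich_le_sqr (incident_linear points_inj lines_inj)) => p /richQ.
by rewrite -(ltr_nat R); apply: lt_le_trans.
Qed.

Section InductionStep.
Variables (S : {set LT}) (Q : {set PT}) (d : R).
Hypothesis kd_gt1 : 1 < kappa * d.
Hypothesis d_le : d ^+ 2 <= 4 * #|S|%:R.
Hypothesis richQ : {in Q, forall p, d <= #|pencil S p|%:R}.
Hypothesis induction : forall S' Q', (#|S'| < #|S|)%N ->
  {in Q', forall p, (1 - kappa) * d <= #|pencil S' p|%:R} ->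
  #|Q'|%:R * ((1 - kappa) * d) ^+ 3 <=
    rich_const * #|S'|%:R ^+ 2 + 4 * (#|S'|%:R * ((1 - kappa) * d) ^+ 2).

Lemma degree_gt0 : 0 < d.
Proof. by rewrite -(pmulr_rgt0 _ (kappa_gt0 R)) (lt_trans _ kd_gt1). Qed.

Lemma card_family_gt0 : 0 < #|S|%:R :> R.
Proof. by have := exprn_gt0 2 degree_gt0; move: d_le; lra. Qed.

Lemma card_few_lines_le (T : {set LT}) (a : R) : T \subset S ->
  a < 1 -> #|S :\: T|%:R <= a * #|S|%:R ->
  (1 - delta / 2) * (#|[set p in Q | #|pencil T p|%:R < kappa * d]|%:R * d ^+ 3) <=
    (rich_const * a ^+ 2 + 16) * #|S|%:R ^+ 2.
Proof.
move=> sTS a_lt1 ST_le; have S_gt0 := card_family_gt0.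
apply: (rich_bound_subfamily degree_gt0 d_le (ler0n _ _) ST_le (ltW a_lt1)) => //.
apply: induction => [|p /setIdP[/richQ]].
  by rewrite -(ltr_nat R); apply: le_lt_trans ST_le _; rewrite gtr_pMl.
by rewrite card_pencilD //; lra.
Qed.

Lemma card_transversal_le z r : 0 <= r ->
  let A := disc s S z r in
  let B := S :\: [set l in S | sqnorm (s l - z) < 100 * r] in
  delta * #|S|%:R <= #|A|%:R -> delta * #|S|%:R <= #|B|%:R ->
  #|[set p in Q | (kappa * d <= #|pencil A p|%:R) &&
                  (kappa * d <= #|pencil B p|%:R)]|%:R * (kappa * d) ^+ 3 <=
    128 * #|S|%:R ^+ 2.
Proof.
move=> r_ge0 A B A_ge B_ge; set Qt := finset _.
move: (r_ge0); rewrite le_eqVlt => /orP[/eqP r0|r_gt0].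
  suff -> : Qt = set0 by rewrite cards0 mul0r mulr_ge0 ?exprn_ge0.
  apply/setP => p; rewrite !inE; apply/negP => /and3P[_ richA _].
  have parallel : {in A, forall l, s l = z}.
    move=> l /setIdP[_]; rewrite -r0 => z_le0; apply/eqP.
    by rewrite -subr_eq0 -sqnorm_eq0 eq_le z_le0 sqnorm_ge0.
  have := card_pencil_parallel_le1 p parallel.
  rewrite leqNgt -(ltr_nat R) => /negP; apply; exact: lt_le_trans richA.
have kd2_le : (kappa * d) ^+ 2 <= 4 * (delta * #|S|%:R).
  rewrite exprMn; apply: (@le_trans _ _ (kappa ^+ 2 * (4 * #|S|%:R))).
    by rewrite ler_pM2l ?exprn_gt0 ?kappa_gt0.
  rewrite mulrCA ler_pM2l // ler_pM2r ?card_family_gt0 //.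
  by move: (kappa_gt0 R) (delta_le_half R); rewrite deltaE; nra.
apply: le_trans (_ : 128 * (#|A|%:R * #|B|%:R) <= _).
  apply: (@card_two_directions_le R PT LT x y s t points_inj lines_inj Qt (kappa * d)
    _ A B z r r_gt0).
  - exact: lt_trans kd_gt1.
  - by move=> l /setIdP[].
  - by move=> l; rewrite !inE => /andP[+ lS]; rewrite lS /= -leNgt.
  - by apply: le_trans kd2_le _; lra.
  - by apply: le_trans kd2_le _; lra.
  - by move=> q /setIdP[_ /andP[]].
  - by move=> q /setIdP[_ /andP[]].
rewrite ler_pM2l // expr2; apply: ler_pM => //; rewrite ler_nat subset_leq_card //.
  by apply/subsetP => l /setIdP[].
exact: subsetDl.
Qed.

Lemma card_rich_step : #|Q|%:R * d ^+ 3 <= rich_const * #|S|%:R ^+ 2.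
Proof.
have S_gt0 := card_family_gt0; have de_gt0 := delta_gt0 R.
have [de_le de_le'] := (delta_le_half R, delta_1600_le R).
have w_gt0 : 0 < delta * #|S|%:R by rewrite mulr_gt0.
have [|z [r [r_ge0 A_ge]]] := @exists_dense_disc R LT s S _ w_gt0.
  by rewrite ler_piMl ?ltW //; lra.
set A := disc s S z r in A_ge *; set D := finset _; rewrite mulrA => D_le.
pose B := S :\: D.
have sAS : A \subset S by apply/subsetP => l /setIdP[].
have sDS : D \subset S by apply/subsetP => l /setIdP[].
have cardA : #|S :\: A|%:R <= (1 - delta) * #|S|%:R :> R.
  by rewrite cardsD (setIidPr sAS) natrB ?subset_leq_card //; lra.
have cardB : #|S :\: B|%:R <= 1600 * delta * #|S|%:R :> R.
  by rewrite setDDr setDv set0U (setIidPr sDS).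
have B_ge : delta * #|S|%:R <= #|B|%:R.
  rewrite cardsD (setIidPr sDS) natrB ?subset_leq_card //.
  by have := ler_wpM2r (ltW S_gt0) de_le; have := ler_wpM2r (ltW S_gt0) de_le'; lra.
have lt1 : 1 - delta < 1 /\ 1600 * delta < 1 by split; lra.
have few_A := card_few_lines_le sAS (proj1 lt1) cardA.
have few_B := card_few_lines_le (subsetDl S D) (proj2 lt1) cardB.
have many := card_transversal_le r_ge0 A_ge B_ge.
have d3_ge0 : 0 <= d ^+ 3 by rewrite exprn_ge0 // ltW // degree_gt0.
apply: le_trans (rich_bound_recombine few_A few_B _ many); last by rewrite mulr_ge0.
rewrite ler_wpM2r // -!natrD ler_nat -/A -/D -/B.
apply: leq_trans (leq_trans (leq_card_setU _ _) (leq_add (leq_card_setU _ _) (leqnn _))).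
apply/subset_leq_card/subsetP => p pQ; rewrite !inE pQ /=.
by case: ltP => //= _; case: ltP.
Qed.

End InductionStep.

Theorem card_rich_le S Q (d : R) : 1 < d ->
  {in Q, forall p, d <= #|pencil S p|%:R} ->
  #|Q|%:R * d ^+ 3 <= rich_const * #|S|%:R ^+ 2 + 4 * (#|S|%:R * d ^+ 2).
Proof.
have [n] := ubnP #|S|; elim: n => // n IH in S Q d *.
rewrite ltnS => leSn d_gt1 richQ; have d_gt0 : 0 < d := lt_trans ltr01 d_gt1.
have d2_gt0 : 0 < d ^+ 2 by rewrite exprn_gt0.
have main_ge0 : 0 <= rich_const * #|S|%:R ^+ 2.
  by rewrite mulr_ge0 ?exprn_ge0 // ltW // rich_const_gt0.
have error_ge0 : 0 <= #|S|%:R * d ^+ 2 by rewrite mulr_ge0 // ltW.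
have [d_large|d_small] := lerP (4 * #|S|%:R) (d ^+ 2).
  have := card_very_rich_le (incident_linear points_inj lines_inj) d_gt0 d_large richQ.
  by rewrite -(ler_pM2r d2_gt0) -mulrA -exprS; lra.
apply: ler_wpDr; first by rewrite mulr_ge0.
have [d_low|d_high] := lerP d kappa^-1; first exact: card_rich_le_of_low_degree.
have kd_gt1 : 1 < kappa * d by rewrite -ltr_pdivrMl ?mulr1 // kappa_gt0.
apply: card_rich_step (ltW d_small) richQ _ => // S' Q' ltS'.
apply: IH; first exact: leq_trans ltS' leSn.
apply: lt_le_trans kd_gt1 _; rewrite ler_pM2r //.
by move: (kappa_gt0 R) (delta_le_half R); rewrite deltaE; lra.
Qed.

End RichPoints.

Lemma sum_inv_cube_le (R : realFieldType) (k m : nat) : (0 < k)%N ->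
  \sum_(i < m) (k + i.+1)%:R ^- 3 <= k%:R ^- 2 - (k + m)%:R ^- 2 :> R.
Proof.
move=> k_gt0; elim: m => [|m IH]; first by rewrite big_ord0 addn0 subrr.
rewrite big_ord_recr /=; apply: le_trans (lerD IH (lexx _)) _.
rewrite addnS -natr1; set u : R := (k + m)%:R.
have u_gt0 : 0 < u by rewrite ltr0n addn_gt0 k_gt0.
have u1_gt0 : 0 < u + 1 by lra.
suff : (u + 1) ^- 3 <= u ^- 2 - (u + 1) ^- 2 by lra.
have -> : u ^- 2 - (u + 1) ^- 2 = (2 * u + 1) / (u ^+ 2 * (u + 1) ^+ 2).
  by field; apply/andP; split; rewrite lt0r_neq0 //; lra.
rewrite ler_pdivlMr ?mulr_gt0 ?exprn_gt0 // mulrC ler_pdivrMr ?exprn_gt0 //.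
by rewrite [X in _ <= _ * X]exprS [leRHS]mulrA ler_pM2r ?exprn_gt0 //; nra.
Qed.

Lemma leq_count_layers n k m : (n <= k + m)%N ->
  (n <= k + \sum_(i < m) (k + i.+1 <= n))%N.
Proof.
elim: m => [|m IH] len; first by rewrite big_ord0.
rewrite big_ord_recr /=; have [/IH|ltn] := leqP n (k + m).
  by rewrite addnA; move/leq_trans; apply; exact: leq_addr.
rewrite (eq_bigr (fun=> 1%N)) => [|i _]; last first.
  by have -> : (k + i.+1 <= n)%N by have := ltn_ord i; lia.
have -> : (k + m.+1 <= n)%N by lia.
by rewrite sum1_card card_ord; lia.
Qed.

Lemma sum_layers_le (I : finType) (Q : {set I}) (f : I -> nat) (k m : nat) :
  {in Q, forall p, (f p <= k + m)%N} ->
  (\sum_(p in Q) f p <=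
   #|Q| * k + \sum_(i < m) #|[set p in Q | k + i.+1 <= f p]|)%N.
Proof.
move=> f_le; rewrite -sum_nat_const.
have -> : (\sum_(i < m) #|[set p in Q | (k + i.+1 <= f p)%N]| =
    \sum_(p in Q) \sum_(i < m) (k + i.+1 <= f p)%N)%N.
  rewrite exchange_big; apply: eq_bigr => i _ /=.
  by rewrite -sum1dep_card big_mkcondr; apply: eq_bigr => p _; case: leqP.
by rewrite -big_split; apply: leq_sum => p /f_le; apply: leq_count_layers.
Qed.

Section SzemerediTrotter.
Variables (R : realType) (PT LT : finType).
Variables (x y : PT -> R[i]) (s t : LT -> R[i]).
Hypothesis points_inj : injective (fun p => (x p, y p)).
Hypothesis lines_inj : injective (fun l => (s l, t l)).
Implicit Types (S : {set LT}) (Q : {set PT}).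

Local Notation inc := (incident x y s t).
Local Notation pencil := (pencil inc).
Local Notation rich_const := (rich_const R).

Lemma card_moderately_rich_le S Q (d : R) : 1 < d ->
  {in Q, forall p, (#|pencil S p| ^ 2 < 4 * #|S|)%N} ->
  {in Q, forall p, d <= #|pencil S p|%:R} ->
  #|Q|%:R <= (rich_const + 16) * #|S|%:R ^+ 2 * d ^- 3.
Proof.
move=> d_gt1 moderate richQ; have d_gt0 : 0 < d := lt_trans ltr01 d_gt1.
have C_gt0 := rich_const_gt0 R.
rewrite ler_pdivlMr ?exprn_gt0 //.
have [->|[p pQ]] := set_0Vmem Q.
  by rewrite cards0 mul0r mulr_ge0 ?exprn_ge0 // addr_ge0 // ltW.
apply: le_trans (card_rich_le points_inj lines_inj d_gt1 richQ) _.
have d2_le : d ^+ 2 <= 4 * #|S|%:R.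
  apply: (@le_trans _ _ (#|pencil S p|%:R ^+ 2)).
    by rewrite ler_sqr ?nnegrE ?richQ // ltW.
  by rewrite -natrX -natrM ler_nat ltnW // moderate.
by have := ler_wpM2l (ler0n R #|S|) d2_le; rewrite [_ ^+ 2 in X in _ -> X]expr2; lra.
Qed.

Lemma sum_moderately_rich_le S Q k : (0 < k)%N ->
  {in Q, forall p, (#|pencil S p| ^ 2 < 4 * #|S|)%N} ->
  (\sum_(p in Q) #|pencil S p|)%:R <=
    #|Q|%:R * k%:R + (rich_const + 16) * #|S|%:R ^+ 2 / k%:R ^+ 2.
Proof.
move=> k_gt0 moderate.
have degree_le : {in Q, forall p, (#|pencil S p| <= k + #|S|)%N}.
  move=> p _; apply: leq_trans (leq_addl _ _).
  by rewrite subset_leq_card // pencil_subset.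
have := sum_layers_le degree_le; rewrite -(ler_nat R) natrD natrM [X in _ + X]natr_sum.
move=> /le_trans; apply; rewrite lerD2l.
apply: (@le_trans _ _ (\sum_(i < #|S|)
    (rich_const + 16) * #|S|%:R ^+ 2 * (k + i.+1)%:R ^- 3)).
  apply: ler_sum => i _; apply: card_moderately_rich_le.
  - by rewrite ltr1n; lia.
  - by move=> p /setIdP[/moderate].
  - by move=> p /setIdP[_]; rewrite ler_nat.
rewrite -mulr_sumr ler_wpM2l ?mulr_ge0 ?exprn_ge0 //.
  by have := rich_const_gt0 R; lra.
apply: le_trans (sum_inv_cube_le R _ k_gt0) _.
by rewrite gerBl invr_ge0 exprn_ge0.
Qed.

Lemma sum_card_pencil_le_threshold S Q k : (0 < k)%N ->
  (\sum_(p in Q) #|pencil S p|)%:R <=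
    #|Q|%:R * k%:R + (rich_const + 16) * #|S|%:R ^+ 2 / k%:R ^+ 2 + 2 * #|S|%:R.
Proof.
move=> k_gt0; pose H := [set p | (4 * #|S| <= #|pencil S p| ^ 2)%N].
rewrite (big_setID H) natrD addrC; apply: lerD; last first.
  rewrite -natrM ler_nat.
  apply: (sum_very_rich_le (incident_linear points_inj lines_inj)) => p.
  by rewrite !inE => /andP[].
have moderate : {in Q :\: H, forall p, (#|pencil S p| ^ 2 < 4 * #|S|)%N}.
  by move=> p; rewrite !inE -ltnNge => /andP[].
apply: le_trans (sum_moderately_rich_le k_gt0 moderate) _.
by rewrite lerD2r ler_wpM2r // ler_nat subset_leq_card // subsetDl.
Qed.

Lemma card_incident_pairs :
  #|[set pl | inc pl.1 pl.2]| = (\sum_(p in [set: PT]) #|pencil setT p|)%N.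
Proof.
rewrite -sum1dep_card -(pair_big_dep xpredT inc (fun _ _ => 1%N)) /=.
apply: eq_big => [p|p _]; first by rewrite inE.
by rewrite sum1dep_card; apply: eq_card => l; rewrite !inE.
Qed.

Theorem szemeredi_trotter (n : nat) : (0 < n)%N ->
  (#|PT| <= n)%N -> (#|LT| <= n)%N ->
  #|[set pl | inc pl.1 pl.2]|%:R <= (rich_const + 20) * n%:R `^ (4 / 3).
Proof.
move=> n_gt0 cardP cardL; pose N : R := n%:R; pose r := N `^ (1 / 3).
have N_gt0 : 0 < N by rewrite ltr0n.
have r_gt0 : 0 < r by rewrite powR_gt0.
have r3 : r ^+ 3 = N.
  rewrite -powR_mulrn ?powR_ge0 // -powRrM (_ : 1 / 3 * 3%:R = 1); last by field.
  by rewrite powRr1 // ltW.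
have r_ge1 : 1 <= r by rewrite -(@ler_pXn2r _ 3) ?nnegrE ?(ltW r_gt0) // r3 expr1n ler1n.
have -> : n%:R `^ (4 / 3) = N * r.
  rewrite /r -[X in _ = X * _]powRr1 ?ltW // -powRD; last first.
    by apply/implyP => _; rewrite gt_eqF.
  by congr (_ `^ _); field.
have [lt_ceil ceil_le] : r < (Num.truncn r).+1%:R /\ (Num.truncn r).+1%:R <= 2 * r.
  by have /andP[le_r lt_r] := truncn_itv (ltW r_gt0); split=> //; rewrite -natr1; lra.
rewrite card_incident_pairs.
apply: le_trans (@sum_card_pencil_le_threshold setT setT (Num.truncn r).+1 isT) _.
have [P_le L_le] : #|[set: PT]|%:R <= N /\ #|[set: LT]|%:R <= N.
  by rewrite !cardsT !ler_nat.
have NrE : N ^+ 2 / r ^+ 2 = N * r by rewrite -r3; field; rewrite gt_eqF.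
have C_gt0 := rich_const_gt0 R.
have points_term : #|[set: PT]|%:R * (Num.truncn r).+1%:R <= N * (2 * r) by apply: ler_pM.
have rich_term : (rich_const + 16) * #|[set: LT]|%:R ^+ 2 / (Num.truncn r).+1%:R ^+ 2 <=
    (rich_const + 16) * (N * r).
  rewrite -NrE -[leLHS]mulrA ler_wpM2l //; first lra.
  apply: ler_pM; rewrite ?invr_ge0 ?exprn_ge0 //; first by rewrite ler_sqr ?nnegrE // ltW.
  by rewrite lef_pV2 ?posrE ?exprn_gt0 // ler_sqr ?nnegrE ltW.
have very_rich_term : 2 * #|[set: LT]|%:R <= 2 * N by rewrite ler_pM2l.
apply: le_trans (lerD (lerD points_term rich_term) very_rich_term) _.
have : N <= N * r by rewrite ler_peMr // ltW.
by lra.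
Qed.

End SzemerediTrotter.

(** * Elimination of one variable *)

Section GeneratedIdeal.
Variables (K : fieldType) (G : {poly K} -> Prop).
Implicit Types (f g h u : {poly K}).

Definition ideal h : Prop := exists s : seq ({poly K} * {poly K}),
  (forall t, t \in s -> G t.2) /\ h = \sum_(t <- s) t.1 * t.2.

Lemma ideal0 : ideal 0.
Proof. by exists [::]; rewrite big_nil. Qed.

Lemma ideal_gen f : G f -> ideal f.
Proof.
by move=> Gf; exists [:: (1, f)]; rewrite big_seq1 mul1r; split=> // t;
  rewrite inE => /eqP ->.
Qed.

Lemma idealD g h : ideal g -> ideal h -> ideal (g + h).
Proof.
move=> [s [sG ->]] [s' [s'G ->]]; exists (s ++ s'); rewrite big_cat; split=> // t.
by rewrite mem_cat => /orP[/sG|/s'G].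
Qed.

Lemma idealM u h : ideal h -> ideal (u * h).
Proof.
move=> [s [sG ->]]; exists [seq (u * t.1, t.2) | t <- s]; split.
  by move=> _ /mapP[t /sG Gt ->].
by rewrite big_map mulr_sumr; apply: eq_bigr => t _; rewrite mulrA.
Qed.

Lemma zero_generators_or : (forall f, G f -> f = 0) \/ exists2 f, G f & f != 0.
Proof.
case: (pselect (exists2 f, G f & f != 0)) => [|all0]; [by right | left=> f Gf].
by apply: contrapT => /eqP nz; apply: all0; exists f.
Qed.

Lemma ideal_principal : exists2 e, ideal e & forall f, G f -> e %| f.
Proof.
have [all0|[f1 Gf1 nz1]] := zero_generators_or.
  by exists 0; [exact: ideal0 | move=> f /all0 ->].
pose P n := `[< exists h, [/\ ideal h, h != 0 & size h = n] >].
have exP : exists n, P n.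
  by exists (size f1); apply/asboolP; exists f1; split=> //; exact: ideal_gen.
have [_ /asboolP[e [ie nze <-]] emin] := ex_minnP exP.
exists e => // f Gf; apply: contrapT => /negP; rewrite /dvdp => nzmod.
have imod : ideal (f %% e).
  have -> : f %% e = f + - (f %/ e) * e.
    by rewrite {2}(divp_eq f e) mulNr addrAC subrr add0r.
  by apply: idealD; [exact: ideal_gen | exact: idealM].
have : P (size (f %% e)) by apply/asboolP; exists (f %% e).
by move=> /emin; rewrite leqNgt ltn_modp nze.
Qed.

Lemma ideal_bounded_coefs B n h : (forall f, G f -> (size f <= B.+1)%N) ->
  (2 * B <= n)%N -> ideal h -> (size h <= n)%N ->
  exists2 s : seq ({poly K} * {poly K}),
    forall t, t \in s -> G t.2 /\ (size t.1 <= n)%N & h = \sum_(t <- s) t.1 * t.2.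
Proof.
move=> sizeG leBn [s [sG hE]] sizeh.
have [all0|[f1 Gf1 nz1]] := zero_generators_or.
  exists [::] => //; rewrite big_nil hE big_seq big1 // => t /sG/all0 ->.
  by rewrite mulr0.
pose rem := \sum_(t <- s) (t.1 %% f1) * t.2; pose quo := \sum_(t <- s) (t.1 %/ f1) * t.2.
have h_split : h = rem + quo * f1.
  rewrite hE /rem /quo mulr_suml -big_split /=; apply: eq_bigr => t _.
  by rewrite {1}(divp_eq t.1 f1) mulrDl addrC mulrAC.
have size_mod u : (size (u %% f1)%R <= B)%N.
  by rewrite -ltnS (leq_trans _ (sizeG _ Gf1)) // ltn_modp.
have size_rem : (size rem <= n)%N.
  rewrite /rem big_seq; elim/big_ind: _ => [|a b sa sb|t /sG Gt].
  - by rewrite size_poly0.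
  - by apply: leq_trans (size_polyD _ _) _; rewrite geq_max sa.
  apply: leq_trans (size_polyMleq _ _) (leq_trans _ leBn).
  rewrite -subn1 leq_subLR; apply: leq_trans (leq_add (size_mod _) (sizeG _ Gt)) _.
  by lia.
have size_quo : (size (quo * f1)%R <= n)%N.
  have -> : quo * f1 = h - rem by rewrite h_split addrC addKr.
  by apply: leq_trans (size_polyD _ _) _; rewrite size_polyN geq_max sizeh.
exists (rcons [seq (t.1 %% f1, t.2) | t <- s] (quo, f1)); last first.
  by rewrite -cats1 big_cat big_map big_seq1 h_split.
move=> t; rewrite mem_rcons inE => /predU1P[->|/mapP[t' /sG Gt' ->]] /=; split=> //.
  have [->|nz_quo] := eqVneq quo 0; first by rewrite size_poly0.
  apply: leq_trans size_quo.
  by rewrite size_mul // -subn1 -addnBA ?size_poly_gt0 // leq_addr.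
by apply: leq_trans (size_mod _) _; lia.
Qed.

End GeneratedIdeal.

Lemma closed_nonroot (K : closedFieldType) (h : {poly K}) :
  h != 0 -> exists z, ~~ root h z.
Proof.
move=> nz; have : size (h * 'X - 1) != 1%N.
  have sizeX : size (h * 'X) = (size h).+1 by rewrite size_mulX.
  rewrite size_polyDl sizeX; first by rewrite eqSS size_poly_eq0.
  by rewrite size_polyN size_poly1 ltnS size_poly_gt0.
move=> /closed_rootP[z]; rewrite rootE !hornerE subr_eq0 => /eqP hz1.
exists z; rewrite rootE; apply/eqP => hz0.
by move: hz1; rewrite hz0 mul0r => /esym/eqP; rewrite oner_eq0.
Qed.

Lemma closed_dvdp_exp (K : closedFieldType) (e g : {poly K}) n :
  (size e <= n.+1)%N -> (forall z, root e z -> root g z) -> e != 0 -> e %| g ^+ n.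
Proof.
move=> sizee root_sub nze; have [rs eE] := closed_field_poly_normal e.
have lead_nz : lead_coef e != 0 by rewrite lead_coef_eq0.
have size_rs : (size rs <= n)%N.
  by move: sizee; rewrite eE size_scale // size_prod_XsubC.
have root_rs z : z \in rs -> root g z.
  by move=> zrs; apply: root_sub; rewrite eE rootZ // root_prod_XsubC.
rewrite eE dvdpZl //; apply: dvdp_trans (dvdp_exp2l g size_rs).
elim: rs root_rs {eE size_rs} => [|z rs IH] root_rs; first by rewrite big_nil.
rewrite big_cons exprS dvdp_mul //.
  by rewrite dvdp_XsubCl root_rs ?inE ?eqxx.
by apply: IH => u urs; rewrite root_rs ?inE ?urs ?orbT.
Qed.

Lemma nullstellensatz (K : closedFieldType) (G : {poly K} -> Prop) B (g : {poly K}) :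
  (0 < B)%N -> (forall f, G f -> (size f <= B.+1)%N) ->
  (forall z, (forall f, G f -> root f z) -> root g z) -> ideal G (g ^+ B).
Proof.
move=> B_gt0 sizeG g_vanish; have [all0|[f1 Gf1 nz1]] := zero_generators_or G.
  suff -> : g = 0 by rewrite expr0n eqn0Ngt B_gt0; exact: ideal0.
  apply: contrapT => /eqP /closed_nonroot[z /negP]; apply; apply: g_vanish => f /all0 ->.
  exact: root0.
have [e ie e_dvd] := ideal_principal G.
have nze : e != 0 by apply: contraNneq nz1 => e0; rewrite -dvd0p -e0 e_dvd.
have sizee : (size e <= B.+1)%N.
  by apply: leq_trans (sizeG f1 Gf1); rewrite dvdp_leq // e_dvd.
have root_sub z : root e z -> root g z.
  by move=> ez; apply: g_vanish => f /e_dvd /root_dvdp; apply.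
by have /dvdpP[q ->] := closed_dvdp_exp sizee root_sub nze; exact: idealM.
Qed.

Section Minors.
Variable A : comNzRingType.

Definition minor r (w : 'I_r -> {poly A}) (rho : 'I_r -> nat) : A :=
  \det (\matrix_(i, j) (w j)`_(rho i)).

Definition border T r (f : 'I_r -> T) (a : T) (i : 'I_r.+1) : T :=
  if unlift ord_max i is Some j then f j else a.

Lemma border_lift T r (f : 'I_r -> T) a i : border f a (lift ord_max i) = f i.
Proof. by rewrite /border liftK. Qed.

Lemma border_max T r (f : 'I_r -> T) a : border f a ord_max = a.
Proof. by rewrite /border unlift_none. Qed.

Lemma borderP T r (f : 'I_r -> T) a (P : T -> Prop) :
  (forall i, P (f i)) -> P a -> forall i, P (border f a i).
Proof. by move=> Pf Pa i; rewrite /border; case: unliftP. Qed.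

Lemma border_eta T r (f : 'I_r.+1 -> T) :
  f = border (fun j => f (lift ord_max j)) (f ord_max).
Proof. by apply/funext => j; rewrite /border; case: unliftP => [j'|] ->. Qed.

Lemma minor_border_row r (w : 'I_r.+1 -> {poly A}) (rho : 'I_r -> nat) :
  exists2 c : 'I_r.+1 -> A, c ord_max = minor (fun j => w (lift ord_max j)) rho &
    forall k, minor w (border rho k) = \sum_j (w j)`_k * c j.
Proof.
pose N := \matrix_(i < r, j < r.+1) (w j)`_(rho i).
exists (fun j : 'I_r.+1 => (-1) ^+ (r + j) * \det (col' j N)) => [|k].
  rewrite -signr_odd oddD addbb expr0 mul1r; congr (\det _).
  by apply/matrixP => a b; rewrite !mxE.
rewrite /minor (expand_det_row _ ord_max); apply: eq_bigr => j _.
rewrite mxE border_max /cofactor; congr (_ * (_ * \det _)).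
by apply/matrixP => a b; rewrite !mxE border_lift.
Qed.

Lemma minor_border_col r (w : 'I_r -> {poly A}) (rho : 'I_r.+1 -> nat) :
  exists c : 'I_r.+1 -> A,
    forall v, minor (border w v) rho = \sum_i v`_(rho i) * c i.
Proof.
pose N := \matrix_(i < r.+1, j < r) (w j)`_(rho i).
exists (fun i : 'I_r.+1 => (-1) ^+ (i + r) * \det (row' i N)) => v.
rewrite /minor (expand_det_col _ ord_max); apply: eq_bigr => i _.
rewrite mxE border_max /cofactor; congr (_ * (_ * \det _)).
by apply/matrixP => a b; rewrite !mxE border_lift.
Qed.

Lemma minor_few_rows r (w : 'I_r -> {poly A}) (rho : 'I_r -> nat) m :
  (forall i, (rho i < m)%N) -> (m < r)%N -> minor w rho = 0.
Proof.
move=> rho_lt ltmr.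
have /injectivePn[i [j nij rhoE]] : ~~ injectiveb (fun i => Ordinal (rho_lt i)).
  apply/negP => /injectiveP /leq_card; rewrite !card_ord.
  by rewrite leqNgt ltmr.
apply: (@determinant_alternate _ _ _ i j) => // k; rewrite !mxE.
by case: rhoE => ->.
Qed.

Lemma minor_border_span (K : fieldType) (psi : {rmorphism A -> K}) r
    (w : 'I_r -> {poly A}) (rho : 'I_r.+1 -> nat) v (s : seq (K * {poly A})) :
  map_poly psi v = \sum_(t <- s) t.1 *: map_poly psi t.2 ->
  (forall t, t \in s -> psi (minor (border w t.2) rho) = 0) ->
  psi (minor (border w v) rho) = 0.
Proof.
move=> vE vanish; have [c cE] := minor_border_col w rho.
have linE u : psi (minor (border w u) rho) =
    \sum_i (map_poly psi u)`_(rho i) * psi (c i).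
  by rewrite cE rmorph_sum; apply: eq_bigr => i _; rewrite coef_map rmorphM.
rewrite linE vE; under eq_bigr => i _ do rewrite coef_sum mulr_suml.
rewrite exchange_big /= big_seq big1 // => t /vanish tE.
transitivity (t.1 * psi (minor (border w t.2) rho)); last by rewrite tE mulr0.
by rewrite linE mulr_sumr; apply: eq_bigr => i _; rewrite coefZ mulrA.
Qed.

(* Otherwise expanding along the new row gives a linear relation between the
   columns in which [v] has a nonzero coefficient; evaluate it at [a]. *)
Lemma exists_minor_border_neq0 (F : fieldType) (phi : {rmorphism A -> F}) (a : F) m r
    (w : 'I_r -> {poly A}) (rho : 'I_r -> nat) (v : {poly A}) :
  (forall j, (size (w j) <= m)%N) -> (size v <= m)%N ->
  (forall j, root (map_poly phi (w j)) a) -> ~~ root (map_poly phi v) a ->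
  phi (minor w rho) != 0 ->
  exists2 k, (k < m)%N & phi (minor (border w v) (border rho k)) != 0.
Proof.
move=> sizew sizev rootw nrootv nz; apply: contrapT => all0.
have vanish k : (k < m)%N -> phi (minor (border w v) (border rho k)) = 0.
  by move=> ltkm; apply: contrapT => /eqP nzk; apply: all0; exists k.
have [c cmax cE] := minor_border_row (border w v) rho.
have relation : \sum_j phi (c j) *: map_poly phi (border w v j) = 0.
  apply/polyP => k; rewrite coef_sum coef0.
  have [ltkm|lemk] := ltnP k m.
    rewrite -[RHS](vanish k ltkm) cE rmorph_sum; apply: eq_bigr => j _.
    by rewrite coefZ coef_map /= rmorphM mulrC.
  rewrite big1 // => j _; rewrite coefZ coef_map /= nth_default ?rmorph0 ?mulr0 //.
  apply: leq_trans lemk; move: j.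
  by apply: (borderP (P := fun u : {poly A} => (size u <= m)%N)).
have := congr1 (fun q => q.[a]) relation; rewrite horner0 horner_sum (bigD1 ord_max) //=.
rewrite big1 ?addr0 => [|j].
  rewrite hornerZ border_max cmax => /eqP; rewrite mulf_eq0 -rootE (negbTE nrootv) orbF.
  by under [X in minor X _]funext => j do rewrite border_lift; rewrite (negbTE nz).
rewrite hornerZ /border; case: unliftP => [j' _ _|->]; last by rewrite eqxx.
by rewrite (rootP (rootw j')) mulr0.
Qed.

End Minors.

Section Elimination.
Variables (A : comNzRingType) (E : {poly A} -> Prop) (g : {poly A}) (B : nat).
Hypothesis B_gt0 : (0 < B)%N.
Hypothesis sizeE : forall f, E f -> (size f <= B.+1)%N.
Hypothesis sizeg : (size g <= B.+1)%N.

(* Enough for the cofactors of [ideal_bounded_coefs] when [g ^+ B] belongs to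
   the ideal generated by [E]. *)
Definition num_shifts : nat := (B ^ 2 + B)%N.

Definition num_rows : nat := (num_shifts + B)%N.

Definition shifted_generator (w : {poly A}) : Prop :=
  exists f n, [/\ E f, (n < num_shifts)%N & w = 'X^n * f].

Lemma size_shifted_generator w : shifted_generator w -> (size w <= num_rows)%N.
Proof.
move=> [f [n [/sizeE szf ltn ->]]]; apply: leq_trans (size_polyMleq _ _) _.
by rewrite size_polyXn /num_rows; lia.
Qed.

Lemma size_exp_le : (size (g ^+ B) <= num_shifts)%N.
Proof.
apply: leq_trans (size_poly_exp_leq _ _) _; rewrite /num_shifts -mulnn.
have : ((size g).-1 * B <= B * B)%N by rewrite leq_mul2r; move: sizeg; lia.
by move: B_gt0; lia.
Qed.

Definition shift_minor r (e : A) : Prop := exists w (rho : 'I_r -> nat),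
  [/\ forall j, shifted_generator (w j), forall i, (rho i < num_rows)%N &
      e = minor w rho].

Section ClosedField.
Variables (K : closedFieldType) (psi : {rmorphism A -> K}).

Lemma exp_span_shifted_generators :
  (forall z, (forall f, E f -> root (map_poly psi f) z) -> root (map_poly psi g) z) ->
  exists2 s : seq (K * {poly A}), forall t, t \in s -> shifted_generator t.2 &
    map_poly psi (g ^+ B) = \sum_(t <- s) t.1 *: map_poly psi t.2.
Proof.
move=> g_vanish; pose G q := exists2 f, E f & q = map_poly psi f.
have sizeG q : G q -> (size q <= B.+1)%N.
  by move=> [f /sizeE szf ->]; apply: leq_trans (size_poly _ _) szf.
have : ideal G (map_poly psi g ^+ B).
  apply: nullstellensatz => // z zG; apply: g_vanish => f Ef; apply: zG.
  by exists f.
rewrite -rmorphXn => /(ideal_bounded_coefs sizeG (n := num_shifts)).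
case=> [||s sP ->]; first by rewrite /num_shifts -mulnn; move: B_gt0; nia.
  exact: leq_trans (size_poly _ _) size_exp_le.
elim: s sP => [|t s IH] sP; first by exists [::]; rewrite // !big_nil.
rewrite big_cons; have [|s' s'P ->] := IH.
  by move=> t' t's; apply: sP; rewrite inE t's orbT.
have [[f Ef tE] size_t] := sP t (mem_head _ _).
exists ([seq (t.1`_i, 'X^i * f) | i : 'I_(size t.1)] ++ s').
  move=> t'; rewrite mem_cat => /orP[/imageP[i _ ->]|/s'P //] /=; exists f, i; split=> //.
  exact: leq_trans (ltn_ord i) size_t.
rewrite big_cat big_map big_enum /=; congr (_ + _).
rewrite -{1}[t.1]coefK poly_def tE mulr_suml.
by apply: eq_bigr => i _; rewrite rmorphM /= map_polyXn scalerAl.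
Qed.

End ClosedField.

Lemma exists_maximal_minor (F : fieldType) (phi : {rmorphism A -> F}) :
  exists r (w : 'I_r -> {poly A}) (rho : 'I_r -> nat),
    [/\ (r <= num_rows)%N, forall j, shifted_generator (w j),
        forall i, (rho i < num_rows)%N, phi (minor w rho) != 0 &
        forall e, shift_minor r.+1 e -> phi e = 0].
Proof.
pose P r := `[< exists2 e, shift_minor r e & phi e != 0 >].
have exP : exists r, P r.
  exists 0%N; apply/asboolP; exists 1; last by rewrite rmorph1 oner_eq0.
  have no (T : Type) : 'I_0 -> T by case.
  by exists (@no _), (@no _); split=> [[]//|[]//|]; rewrite /minor det_mx00.
have leP r : P r -> (r <= num_rows)%N.
  move=> /asboolP[_ [w [rho [_ rho_lt ->]]]]; rewrite leqNgt.
  by apply: contra => ltr; rewrite (minor_few_rows _ rho_lt ltr) rmorph0.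
have [r Pr rmax] := ex_maxnP exP leP.
have /asboolP[_ [w [rho [wP rho_lt ->]]] nz] := Pr.
exists r, w, rho; split=> // [|e me]; first exact: leP.
apply: contrapT => /eqP nze; have /rmax : P r.+1 by apply/asboolP; exists e.
by rewrite ltnn.
Qed.

Definition extends_solutions (E' : A -> Prop) (g' : A) : Prop :=
  forall (K : closedFieldType) (psi : {rmorphism A -> K}),
    (forall e, E' e -> psi e = 0) -> psi g' != 0 ->
    exists2 z, forall f, E f -> root (map_poly psi f) z & ~~ root (map_poly psi g) z.

Variables (F : fieldType) (phi : {rmorphism A -> F}) (a : F).
Hypothesis rootE_a : forall f, E f -> root (map_poly phi f) a.
Hypothesis nroot_ga : ~~ root (map_poly phi g) a.

(* [r] is the rank under [phi] of the matrix of shifted generators: the minors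
   of size [r + 1] vanish there, while bordering one of size [r] by [g ^+ B]
   gives a nonzero minor, since [g] does not vanish at [a]. *)
Theorem elimination : exists r (w : 'I_r -> {poly A}) (rho : 'I_r.+1 -> nat),
  let g' := minor (border w (g ^+ B)) rho in
  [/\ (r <= num_rows)%N, forall j, shifted_generator (w j),
      forall e, shift_minor r.+1 e -> phi e = 0, phi g' != 0 &
      extends_solutions (shift_minor r.+1) g'].
Proof.
have [r [w [rho [r_le wP rho_lt nz vanish]]]] := exists_maximal_minor phi.
have [||||k k_lt nzk] :=
    exists_minor_border_neq0 (v := g ^+ B) (m := num_rows) (a := a) _ _ _ _ nz.
- by move=> j; apply: size_shifted_generator.
- exact: leq_trans size_exp_le (leq_addr _ _).
- by move=> j; have [f [n [Ef _ ->]]] := wP j; rewrite rmorphM /= rootM (rootE_a Ef) orbT.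
- by rewrite rmorphXn rootE horner_exp expf_eq0 B_gt0 /= -rootE.
exists r, w, (border rho k); split=> // K psi psi_vanish psi_nz.
apply: contrapT => no_solution.
have [|s sP sE] := @exp_span_shifted_generators K psi.
  by move=> z zE; apply: contrapT => /negP ngz; apply: no_solution; exists z.
case/negP: psi_nz; apply/eqP; apply: minor_border_span sE _ => t /sP tP.
apply: psi_vanish; exists (border w t.2), (border rho k); split=> //.
  exact: borderP.
exact: (borderP (P := fun i => (i < num_rows)%N)).
Qed.

End Elimination.

(** * Transfer of polynomial systems to characteristic zero *)

Record is_weight (A : nzRingType) (nu : A -> nat) : Prop := IsWeight {
  weight0 : nu 0 = 0%N;
  weight_eq0 : forall f, nu f = 0%N -> f = 0;
  weight1 : nu 1 = 1%N;
  weightN : forall f, nu (- f) = nu f;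
  weightD : forall f g, (nu (f + g)%R <= nu f + nu g)%N;
  weightM : forall f g, (nu (f * g)%R <= nu f * nu g)%N }.

Lemma absz_weight : is_weight absz.
Proof.
split=> //; first by move=> f /eqP; rewrite absz_eq0 => /eqP.
- exact: abszN.
- by move=> f g; lia.
- by move=> f g; rewrite abszM.
Qed.

Section Weights.
Variables (A : nzRingType) (nu : A -> nat).
Hypothesis nuP : is_weight nu.

Lemma weightB f g : (nu (f - g)%R <= nu f + nu g)%N.
Proof. by rewrite -(weightN nuP g) (weightD nuP). Qed.

Lemma weight_sign b f : nu ((-1) ^+ b * f) = nu f.
Proof.
by rewrite -signr_odd; case: odd; rewrite ?expr1 ?mulN1r ?(weightN nuP) ?expr0 ?mul1r.
Qed.

Lemma weight_sum (I : Type) (r : seq I) (P : pred I) (F : I -> A) :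
  (nu (\sum_(i <- r | P i) F i)%R <= \sum_(i <- r | P i) nu (F i))%N.
Proof.
elim/big_rec2: _ => [|i m h _ IH]; first by rewrite (weight0 nuP).
by apply: leq_trans (weightD nuP _ _) _; rewrite leq_add2l.
Qed.

Lemma weight_prod (I : Type) (r : seq I) (P : pred I) (F : I -> A) :
  (nu (\prod_(i <- r | P i) F i)%R <= \prod_(i <- r | P i) nu (F i))%N.
Proof.
elim/big_rec2: _ => [|i m h _ IH]; first by rewrite (weight1 nuP).
by apply: leq_trans (weightM nuP _ _) _; rewrite leq_mul2l IH orbT.
Qed.

Lemma weightX f n : (nu (f ^+ n)%R <= nu f ^ n)%N.
Proof.
elim: n => [|n IH]; first by rewrite expr0 (weight1 nuP).
by rewrite exprS expnS; apply: leq_trans (weightM nuP _ _) _; rewrite leq_mul2l IH orbT.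
Qed.

(* Over the integers this is the sum of the absolute values of the
   coefficients, weighted by [2] to the degree: its logarithm bounds both the
   degree and the height. *)
Definition poly_weight (f : {poly A}) : nat := (\sum_(i < size f) nu f`_i * 2 ^ i)%N.

Lemma poly_weight_widen (f : {poly A}) m : (size f <= m)%N ->
  poly_weight f = (\sum_(i < m) nu f`_i * 2 ^ i)%N.
Proof.
move=> lefm; rewrite /poly_weight (big_ord_widen m (fun i => nu f`_i * 2 ^ i)%N) //.
rewrite big_mkcond; apply: eq_bigr => i _; case: ltnP => // lefi.
by rewrite nth_default // (weight0 nuP).
Qed.

Lemma weight_coef_le (f : {poly A}) i : (nu f`_i <= poly_weight f)%N.
Proof.
have [lti|lei] := ltnP i (size f); last by rewrite nth_default // (weight0 nuP).
rewrite /poly_weight (bigD1 (Ordinal lti)) //=; apply: leq_trans (leq_addr _ _).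
by rewrite leq_pmulr // expn_gt0.
Qed.

Lemma weight_coefXn_le n (f : {poly A}) i : (nu ('X^n * f)`_i <= poly_weight f)%N.
Proof. by rewrite coefXnM; case: ltnP => _; rewrite ?(weight0 nuP) ?weight_coef_le. Qed.

Lemma poly_weight_size (f : {poly A}) : f != 0 -> (2 ^ (size f).-1 <= poly_weight f)%N.
Proof.
move=> nz; have size_gt0 : (0 < size f)%N by rewrite size_poly_gt0.
have lt_pred : ((size f).-1 < size f)%N by rewrite ltn_predL.
rewrite /poly_weight (bigD1 (Ordinal lt_pred)) //=; apply: leq_trans (leq_addr _ _).
rewrite leq_pmull // lt0n -lead_coefE; apply: contra nz => /eqP /(weight_eq0 nuP) /eqP.
by rewrite lead_coef_eq0.
Qed.

Lemma size_poly_weight (f : {poly A}) b :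
  (poly_weight f <= 2 ^ b)%N -> (size f <= b.+1)%N.
Proof.
have [->|nz] := eqVneq f 0; first by rewrite size_poly0.
move=> /(leq_trans (poly_weight_size nz)); rewrite leq_exp2l //.
by case: (size f).
Qed.

Lemma poly_weightD f g : (poly_weight (f + g) <= poly_weight f + poly_weight g)%N.
Proof.
rewrite (poly_weight_widen (leq_maxl (size f) (size g))).
rewrite (poly_weight_widen (leq_maxr (size f) (size g))).
rewrite (poly_weight_widen (size_polyD f g)) -big_split /=; apply: leq_sum => i _.
by rewrite -mulnDl leq_mul2r coefD (weightD nuP) orbT.
Qed.

Lemma poly_weightZ c f : (poly_weight (c *: f) <= nu c * poly_weight f)%N.
Proof.
rewrite (poly_weight_widen (size_scale_leq c f)) big_distrr /=; apply: leq_sum => i _.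
by rewrite coefZ mulnA leq_mul2r (weightM nuP) orbT.
Qed.

Lemma poly_weightXnM n f : (poly_weight ('X^n * f) <= 2 ^ n * poly_weight f)%N.
Proof.
have sizeXn : (size ('X^n * f)%R <= n + size f)%N.
  by apply: leq_trans (size_polyMleq _ _) _; rewrite size_polyXn.
rewrite (poly_weight_widen sizeXn) big_split_ord /= big1 ?add0n => [|i _]; last first.
  by rewrite coefXnM ltn_ord (weight0 nuP).
rewrite big_distrr /=; apply: leq_sum => i _.
by rewrite coefXnM ltnNge leq_addr /= addKn expnD mulnCA.
Qed.

Lemma poly_weight_sum_le (I : Type) (r : seq I) (P : pred I) (F : I -> {poly A}) :
  (poly_weight (\sum_(i <- r | P i) F i)%R <= \sum_(i <- r | P i) poly_weight (F i))%N.
Proof.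
elim/big_rec2: _ => [|i m h _ IH]; first by rewrite /poly_weight size_poly0 big_ord0.
by apply: leq_trans (poly_weightD _ _) _; rewrite leq_add2l.
Qed.

Lemma poly_weightM f g : (poly_weight (f * g)%R <= poly_weight f * poly_weight g)%N.
Proof.
rewrite -{1}[f]coefK poly_def mulr_suml; apply: leq_trans (poly_weight_sum_le _ _ _) _.
rewrite [X in (_ <= X * _)%N]/poly_weight big_distrl /=; apply: leq_sum => i _.
rewrite -scalerAl; apply: leq_trans (poly_weightZ _ _) _.
by rewrite -mulnA leq_mul2l poly_weightXnM orbT.
Qed.

Lemma poly_weightP : is_weight poly_weight.
Proof.
split.
- by rewrite /poly_weight size_poly0 big_ord0.
- move=> f f0; apply/eqP; apply: contraTT (leqnn (poly_weight f)) => nz.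
  by rewrite {2}f0 -ltnNge (leq_trans _ (poly_weight_size nz)) // expn_gt0.
- by rewrite /poly_weight size_poly1 big_ord1 coef1 (weight1 nuP).
- move=> f; rewrite /poly_weight size_polyN; apply: eq_bigr => i _.
  by rewrite coefN (weightN nuP).
- exact: poly_weightD.
- exact: poly_weightM.
Qed.

End Weights.

Lemma weight_det (A : comNzRingType) (nu : A -> nat) n (M : 'M[A]_n) (b : 'I_n -> nat) :
  is_weight nu -> (forall i j, (nu (M i j) <= b j)%N) ->
  (nu (\det M) <= n`! * \prod_j b j)%N.
Proof.
move=> nuP le_b; apply: leq_trans (weight_sum nuP _ _ _) _.
rewrite -card_Sn -sum_nat_const; apply: leq_sum => s _; rewrite (weight_sign nuP).
apply: leq_trans (weight_prod nuP _ _ _) _.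
rewrite [X in (_ <= X)%N](reindex_inj (@perm_inj _ s)) /=.
by apply: leq_prod => i _.
Qed.

Lemma double_sqr_le_exp n : (7 <= n)%N -> (2 * n ^ 2 <= 2 ^ n)%N.
Proof.
elim: n => // n IH; rewrite leq_eqVlt => /orP[/eqP [] <- //|].
rewrite ltnS => len; rewrite -mulnn [(2 ^ n.+1)%N]expnS.
by have := IH len; rewrite -mulnn; move: (2 ^ n)%N => P; nia.
Qed.

Lemma fact_le_exp n m : (n <= m)%N -> (n`! <= m ^ n)%N.
Proof.
elim: n => // n IH len; rewrite factS expnS; apply: leq_mul => //.
by apply: IH; apply: ltnW.
Qed.

Lemma minor_weight_bound B r : (7 <= B)%N -> (r <= num_rows B)%N ->
  (r.+1`! * ((2 ^ B) ^ r * 2 ^ (B * B)) <= 2 ^ (B ^ 4))%N.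
Proof.
rewrite /num_rows /num_shifts => leB ler.
have ler2 : (r.+1 <= 2 * B ^ 2)%N by move: ler; rewrite -mulnn; nia.
have le_fact := fact_le_exp (leq_trans ler2 (double_sqr_le_exp leB)).
apply: leq_trans (leq_mul le_fact (leqnn _)) _.
rewrite -!expnM -!expnD leq_exp2l //.
have -> : (B ^ 4 = B * (B * (B * B)))%N by rewrite !expnS expn0 muln1.
have : (B * r.+1 <= 2 * (B * (B * B)))%N by rewrite mulnCA mulnn leq_mul2l ler2 orbT.
have : (7 * (B * (B * B)) <= B * (B * (B * B)))%N by rewrite leq_mul2r leB orbT.
have : (B * B <= B * (B * B))%N by rewrite leq_mul2l leq_pmulr ?orbT //; lia.
by move: (B * (B * B))%N => u; lia.
Qed.

Lemma weight_minor_border (A : comNzRingType) (nu : A -> nat) r (w : 'I_r -> {poly A})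
    (v : {poly A}) (rho : 'I_r.+1 -> nat) B :
  is_weight nu -> (7 <= B)%N -> (r <= num_rows B)%N ->
  (forall j i, (nu ((w j)`_i)%R <= 2 ^ B)%N) ->
  (forall i, (nu (v`_i)%R <= 2 ^ (B * B))%N) ->
  (nu (minor (border w v) rho) <= 2 ^ (B ^ 4))%N.
Proof.
move=> nuP leB ler w_le v_le.
pose b := border (fun _ : 'I_r => (2 ^ B)%N) (2 ^ (B * B))%N.
apply: leq_trans (weight_det (b := b) nuP _) _.
  move=> i j; rewrite mxE /b /border; case: unliftP => [j' _|_]; first exact: w_le.
  exact: v_le.
apply: leq_trans (minor_weight_bound leB ler); rewrite leq_mul2l; apply/orP; right.
rewrite (bigD1_ord ord_max) //= /b border_max mulnC leq_mul2r; apply/orP; right.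
under eq_bigr => j _ do rewrite border_lift.
by rewrite prod_nat_const card_ord.
Qed.

(* Iterating the univariate construction, rather than using multivariate
   polynomials, singles out the variable to be eliminated. *)
Fixpoint ZX (k : nat) : comNzRingType :=
  if k is k'.+1 then {poly ZX k'} : comNzRingType else int.

Fixpoint ZX_weight (k : nat) : ZX k -> nat :=
  if k is k'.+1 return ZX k -> nat then poly_weight (@ZX_weight k') else absz.

Lemma ZX_weightP k : is_weight (@ZX_weight k).
Proof. by elim: k => [|k IH]; [exact: absz_weight | exact: poly_weightP]. Qed.

Fixpoint ev (F : comNzRingType) (a : nat -> F) k : {rmorphism ZX k -> F} :=
  match k with
  | 0%N => intmul (1 : F) : {rmorphism int -> F}
  | k'.+1 => horner_eval (a k') \o map_poly (ev a k')
               : {rmorphism {poly ZX k'} -> F}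
  end.

Lemma evS (F : comNzRingType) (a : nat -> F) k (f : ZX k.+1) :
  ev a k.+1 f = (map_poly (ev a k) f).[a k].
Proof. by []. Qed.

Lemma eq_ev (F : comNzRingType) (a b : nat -> F) k (f : ZX k) :
  (forall i, (i < k)%N -> a i = b i) -> ev a k f = ev b k f.
Proof.
elim: k f => // k IH f eq_ab; rewrite !evS eq_ab //; congr (_.[_]).
by apply: eq_map_poly => c; apply: IH => i ltik; apply: eq_ab; apply: ltnW.
Qed.

Fixpoint var k (i : nat) : ZX k :=
  match k with
  | 0%N => (0 : int)
  | k'.+1 => (if i == k' then 'X else (var k' i)%:P) : {poly ZX k'}
  end.

Lemma ev_var (F : comNzRingType) (a : nat -> F) k i : (i < k)%N -> ev a k (var k i) = a i.
Proof.
elim: k => // k IH; rewrite ltnS evS /= => leik; case: eqVneq => [->|nik].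
  by rewrite map_polyX hornerX.
by rewrite map_polyC hornerC /= IH // ltn_neqAle nik.
Qed.

Lemma weight_var_le k i : (ZX_weight (var k i) <= 2)%N.
Proof.
elim: k => //= k IH; have nuP := ZX_weightP k; case: eqP => _.
  rewrite /poly_weight size_polyX !big_ord_recl big_ord0 !coefX.
  by rewrite (weight0 nuP) (weight1 nuP).
by rewrite (poly_weight_widen nuP (size_polyC_leq1 _)) big_ord1 coefC eqxx muln1.
Qed.

Section Transfer.
Variables (p : nat) (F : fieldType) (K : numClosedFieldType).
Hypothesis pcharFp : p \in [pchar F].

Lemma small_intr_eq0 (z : int) : (`|z| < p)%N -> z%:~R = 0 :> F -> z = 0.
Proof.
move=> ltzp /eqP; rewrite -(dvdz_pcharf pcharFp) => dvdpz; apply/eqP; rewrite -absz_eq0.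
by apply: contraLR ltzp; rewrite -lt0n -leqNgt => /dvdn_leq; apply.
Qed.

Theorem transfer k : forall (E : ZX k -> Prop) (g : ZX k) B (a : nat -> F),
  (7 <= B)%N -> (2 ^ (B ^ (4 ^ k)) < p)%N ->
  (forall f, E f -> (ZX_weight f <= 2 ^ B)%N) -> (ZX_weight g <= 2 ^ B)%N ->
  (forall f, E f -> ev a k f = 0) -> ev a k g != 0 ->
  exists b : nat -> K, (forall f, E f -> ev b k f = 0) /\ ev b k g != 0.
Proof.
elim: k => [|k IH] E g B a leB ltp weightE weightg Ea ga.
  rewrite expn0 expn1 in ltp.
  exists (fun=> 0); split=> [f Ef|]; last first.
    by move: ga => /=; apply: contra; rewrite intr_eq0 => /eqP ->; rewrite rmorph0.
  suff -> : f = 0 by rewrite rmorph0.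
  by apply: small_intr_eq0 (Ea f Ef); apply: leq_ltn_trans (weightE f Ef) ltp.
have B_gt0 : (0 < B)%N by apply: leq_trans leB.
have [nuP nu'P] := (ZX_weightP k, ZX_weightP k.+1).
have sizeE f : E f -> (size f <= B.+1)%N by move=> /weightE; apply: size_poly_weight.
have rootE_a f : E f -> root (map_poly (ev a k) f) (a k) by move=> /Ea /rootP.
have [r [w [rho [r_le wP vanish nz extend]]]] :=
  elimination B_gt0 sizeE (size_poly_weight nuP weightg) rootE_a ga.
have coef_le v : shifted_generator E B v -> forall i, (ZX_weight v`_i <= 2 ^ B)%N.
  move=> [f [n [Ef _ ->]]] i; apply: leq_trans (weight_coefXn_le nuP _ _ _) _.
  exact: weightE.
have leB4 : (7 <= B ^ 4)%N by rewrite (leq_trans leB) // -{1}[B]expn1 leq_pexp2l.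
have [|||b [bE bg]] := IH _ _ (B ^ 4)%N a leB4 _ _ _ vanish nz.
- by rewrite -expnM -expnS.
- move=> _ [v [rho' [vP _ ->]]]; rewrite [v]border_eta.
  apply: weight_minor_border => // [j|i]; first exact: coef_le.
  by apply: leq_trans (coef_le _ (vP _) _) _; rewrite leq_exp2l // leq_pmulr.
- apply: weight_minor_border => // [j|i]; first exact: coef_le.
  apply: leq_trans (weight_coef_le nuP _ _) _.
  by apply: leq_trans (weightX nu'P _ _) _; rewrite expnM leq_exp2r.
have [z zE zg] := extend _ (ev b k) bE bg.
pose b' i := if i == k then z else b i.
have evE (f : {poly ZX k}) : ev b' k.+1 f = (map_poly (ev b k) f).[z].
  rewrite evS /b' eqxx; congr (_.[_]); apply: eq_map_poly => c.
  by apply: eq_ev => i ik; rewrite ltn_eqF.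
by exists b'; split=> [f /zE/rootP|]; rewrite evE // -rootE.
Qed.

End Transfer.

Definition det3 (A : comNzRingType) (I : Type) (x y : I -> A) i j l : A :=
  (x j - x i) * (y l - y i) - (x l - x i) * (y j - y i).

Lemma rmorph_det3 (A A' : comNzRingType) (phi : {rmorphism A -> A'}) (I : Type)
    (x y : I -> A) i j l :
  phi (det3 x y i j l) = det3 (phi \o x) (phi \o y) i j l.
Proof. by rewrite /det3 !(rmorphB, rmorphM). Qed.

Section LiftedConfigurations.
Variables (T : finType) (F : fieldType) (u w : T -> F).

(* One variable for each of the two coordinates of each point. *)
Local Notation dim := #|{: T + T}|.

Definition abscissa (q : T) : ZX dim := var dim (enum_rank (inl q : T + T)).
Definition ordinate (q : T) : ZX dim := var dim (enum_rank (inr q : T + T)).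
Definition generic_det3 i j l : ZX dim := det3 abscissa ordinate i j l.

Definition coordinates (n : nat) : F :=
  if (insub n : option 'I_dim) is Some i then
    match enum_val i with inl q => u q | inr q => w q end
  else 0.

Lemma ev_abscissa (A : comNzRingType) (a : nat -> A) q :
  ev a dim (abscissa q) = a (enum_rank (inl q : T + T)).
Proof. by rewrite ev_var. Qed.

Lemma ev_ordinate (A : comNzRingType) (a : nat -> A) q :
  ev a dim (ordinate q) = a (enum_rank (inr q : T + T)).
Proof. by rewrite ev_var. Qed.

Lemma ev_coordinates_abscissa q : ev coordinates dim (abscissa q) = u q.
Proof. by rewrite ev_abscissa /coordinates valK enum_rankK. Qed.

Lemma ev_coordinates_ordinate q : ev coordinates dim (ordinate q) = w q.
Proof. by rewrite ev_ordinate /coordinates valK enum_rankK. Qed.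

Lemma ev_coordinates_det3 i j l :
  ev coordinates dim (generic_det3 i j l) = det3 u w i j l.
Proof.
by rewrite rmorph_det3 /det3 /= !ev_coordinates_abscissa !ev_coordinates_ordinate.
Qed.

Lemma weight_var_diff_le i j : (ZX_weight (var dim i - var dim j) <= 4)%N.
Proof.
apply: leq_trans (weightB (ZX_weightP _) _ _) _.
by have := weight_var_le dim i; have := weight_var_le dim j; lia.
Qed.

Lemma weight_generic_det3_le i j l : (ZX_weight (generic_det3 i j l) <= 2 ^ 5)%N.
Proof.
have nuP := ZX_weightP dim; apply: leq_trans (weightB nuP _ _) _.
by apply: (@leq_add _ _ (4 * 4) (4 * 4)); apply: leq_trans (weightM nuP _ _) _;
  apply: leq_mul; exact: weight_var_diff_le.
Qed.

Definition nondegeneracy : ZX dim :=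
  \prod_(ij : T * T | ij.1 != ij.2) (abscissa ij.1 - abscissa ij.2) *
  \prod_(t : T * T * T | det3 u w t.1.1 t.1.2 t.2 != 0) generic_det3 t.1.1 t.1.2 t.2.

Lemma leq_prod_exp2 (I : finType) (P : pred I) (f : I -> nat) b m :
  (forall i, P i -> (f i <= 2 ^ b)%N) -> (#|I| <= m)%N ->
  (\prod_(i | P i) f i <= 2 ^ (b * m))%N.
Proof.
move=> f_le cardI; apply: leq_trans (leq_prod f_le) _.
rewrite prod_nat_const -expnM leq_exp2l // leq_mul2l (leq_trans _ cardI) ?orbT //.
exact: max_card.
Qed.

Lemma weight_nondegeneracy_le : (ZX_weight nondegeneracy <= 2 ^ (7 * #|T| ^ 3))%N.
Proof.
have nuP := ZX_weightP dim; apply: leq_trans (weightM nuP _ _) _.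
rewrite -[7%N]/(2 + 5)%N mulnDl expnD; apply: leq_mul.
  apply: leq_trans (weight_prod nuP _ _ _) (leq_prod_exp2 _ _) => [ij _|].
    exact: weight_var_diff_le.
  by rewrite card_prod mulnn; case: #|T| => // n; rewrite leq_pexp2l.
apply: leq_trans (weight_prod nuP _ _ _) (leq_prod_exp2 _ _) => [t _|].
  exact: weight_generic_det3_le.
by rewrite !card_prod !expnS expn0 muln1 mulnA.
Qed.

Lemma ev_nondegeneracy_neq0 (A : idomainType) (b : nat -> A) :
  ev b dim nondegeneracy != 0 <->
  injective (fun q => ev b dim (abscissa q)) /\
  (forall i j l, det3 u w i j l != 0 -> ev b dim (generic_det3 i j l) != 0).
Proof.
rewrite rmorphM !rmorph_prod mulf_eq0 negb_or /=; split.
  move=> /andP[/prodf_neq0 distinct /prodf_neq0 noncollinear]; split.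
    move=> i j eij; apply/eqP/negPn/negP => nij.
    by have := distinct (i, j) nij; rewrite rmorphB /= eij subrr eqxx.
  by move=> i j l nz; exact: (noncollinear (i, j, l)).
move=> [distinct noncollinear]; apply/andP; split; apply/prodf_neq0.
  by move=> ij nij; rewrite rmorphB /= subr_eq0; apply: contra nij => /eqP /distinct ->.
by move=> t; apply: noncollinear.
Qed.

(* The system has weights at most [2 ^ (7 * n ^ 3 + 7)], and eliminating each of
   the [2 * n] variables raises this exponent to its fourth power. *)
Definition lifting_bound (n : nat) : nat := 2 ^ ((7 * n ^ 3 + 7) ^ (4 ^ (2 * n))).

Theorem exists_lifted_configuration (p : nat) (K : numClosedFieldType) :
  p \in [pchar F] -> (lifting_bound #|T| < p)%N -> injective u ->
  exists x y : T -> K, injective x /\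
    forall i j l, (det3 x y i j l == 0) = (det3 u w i j l == 0).
Proof.
move=> pcharFp ltp u_inj; set B := (7 * #|T| ^ 3 + 7)%N.
pose E f := exists i j l, det3 u w i j l = 0 /\ f = generic_det3 i j l.
have ltp' : (2 ^ (B ^ (4 ^ dim)) < p)%N by rewrite card_sum addnn -mul2n.
have [||||b [bE]] :=
    @transfer p F K pcharFp dim E nondegeneracy B coordinates (leq_addl _ _) ltp'.
- move=> _ [i [j [l [_ ->]]]]; apply: leq_trans (weight_generic_det3_le _ _ _) _.
  by rewrite leq_exp2l // /B; lia.
- by apply: leq_trans weight_nondegeneracy_le _; rewrite leq_exp2l // leq_addr.
- by move=> _ [i [j [l [det0 ->]]]]; rewrite ev_coordinates_det3.
- apply/ev_nondegeneracy_neq0; split=> [i j|i j l nz]; last first.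
    by rewrite ev_coordinates_det3.
  by rewrite !ev_coordinates_abscissa => /u_inj.
move=> /ev_nondegeneracy_neq0[x_inj noncollinear].
exists (fun q => ev b dim (abscissa q)), (fun q => ev b dim (ordinate q)).
split=> // i j l.
rewrite -[det3 _ _ i j l](rmorph_det3 (ev b dim)).
have [det0|nz] := eqVneq (det3 u w i j l) 0; last exact/negbTE/noncollinear.
by apply/eqP/bE; exists i, j, l.
Qed.

End LiftedConfigurations.

(** * Configurations over finite fields *)

Lemma det3_shear (A : comNzRingType) (I : Type) (x y : I -> A) a i j l :
  det3 (fun q => x q + a * y q) y i j l = det3 x y i j l.
Proof. by rewrite /det3; ring. Qed.

Lemma on_chord_det3 (F : fieldType) (I : Type) (x y : I -> F) i j k :
  x i != x j -> let s := (y j - y i) / (x j - x i) in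
  (y k == s * x k + (y i - s * x i)) = (det3 x y i j k == 0).
Proof.
move=> nx s; have nz : x j - x i != 0 by rewrite subr_eq0 eq_sym.
have -> : det3 x y i j k = (x j - x i) * (y k - (s * x k + (y i - s * x i))).
  by rewrite /s /det3; field.
by rewrite mulf_eq0 (negbTE nz) /= subr_eq0.
Qed.

Section Collinearity.
Variable F : finFieldType.
Implicit Types (q : F * F) (l : {set F * F}) (P : {set F * F}) (L : {set {set F * F}}).

Lemma mem_line_det3 l q0 q1 q2 : is_line l -> q0 != q1 -> q0 \in l -> q1 \in l ->
  (q2 \in l) = (det3 fst snd q0 q1 q2 == 0).
Proof.
move=> [a [b [c [ab ->]]]] n01; rewrite !inE => /eqP q0l /eqP q1l.
set z := a * q2.2 + b * q2.1 + c.
have zE : z = a * (q2.2 - q0.2) + b * (q2.1 - q0.1).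
  by rewrite -[LHS]subr0 -q0l /z; ring.
have direction : a * (q1.2 - q0.2) + b * (q1.1 - q0.1) = 0.
  by rewrite -[RHS](subrr 0) -{1}q1l -q0l; ring.
have dx_z : (q1.1 - q0.1) * z = a * det3 fst snd q0 q1 q2.
  rewrite -[RHS]addr0 -(mulr0 (q2.1 - q0.1)) -direction zE /det3; ring.
have dy_z : (q1.2 - q0.2) * z = - (b * det3 fst snd q0 q1 q2).
  rewrite -[RHS]addr0 -(mulr0 (q2.2 - q0.2)) -direction zE /det3; ring.
apply/eqP/eqP => [z0|det0]; apply/eqP.
  move/esym/eqP: dx_z; rewrite z0 mulr0 mulf_eq0 => /orP[/eqP a0|//].
  move/esym/eqP: dy_z; rewrite z0 mulr0 oppr_eq0 mulf_eq0 => /orP[/eqP b0|//].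
  by case: ab; rewrite a0 b0.
move/eqP: dx_z; rewrite det0 mulr0 mulf_eq0 subr_eq0 => /orP[/eqP x01|//].
move/eqP: dy_z; rewrite det0 mulr0 oppr0 mulf_eq0 subr_eq0 => /orP[/eqP y01|//].
by case/negP: n01; rewrite -pair_eqE /= x01 y01 !eqxx.
Qed.

Lemma eq_line l l' q0 q1 : is_line l -> is_line l' -> q0 != q1 ->
  q0 \in l -> q1 \in l -> q0 \in l' -> q1 \in l' -> l = l'.
Proof.
move=> ll ll' n01 q0l q1l q0l' q1l'; apply/setP => q.
by rewrite (mem_line_det3 q ll n01) // (mem_line_det3 q ll' n01).
Qed.

Lemma exists_shear P : (#|P| ^ 2 < #|F|)%N ->
  exists a : F, {in P &, injective (fun q => q.1 + a * q.2)}.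
Proof.
move=> cardP; pose bad (qq : (F * F) * (F * F)) :=
  (qq.2.1 - qq.1.1) / (qq.1.2 - qq.2.2).
have /subsetPn[a _ a_good] : ~~ ([set: F] \subset [set bad qq | qq in setX P P]).
  apply/negP => /subset_leq_card; rewrite cardsT leqNgt; apply/negP/negPn.
  by apply: leq_ltn_trans cardP; rewrite -mulnn -cardsX leq_imset_card.
exists a => q q' qP q'P eqq'.
have slope : a * (q.2 - q'.2) = q'.1 - q.1.
  by rewrite mulrBr; apply/eqP; rewrite subr_eq addrAC -eqq' addrAC subrr add0r.
have [y0|ny] := eqVneq (q.2 - q'.2) 0.
  move: slope; rewrite y0 mulr0 => /esym/eqP; rewrite subr_eq0 => /eqP x0.
  move/eqP: y0; rewrite subr_eq0 => /eqP y0.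
  by apply/eqP; rewrite -pair_eqE /= x0 y0 !eqxx.
case/negP: a_good; apply/imsetP; exists (q, q'); first by rewrite inE qP.
by rewrite /bad /= -slope mulfK.
Qed.

Lemma card_poor_incidences_le P L : {in L, forall l, (#|P :&: l| <= 1)%N} ->
  (#|incidences P L| <= #|L|)%N.
Proof.
move=> poor; have snd_inj : {in incidences P L &, injective snd}.
  move=> [q l] [q' l'] /setIdP[/setXP[qP lL] /= ql] /setIdP[/setXP[q'P _] /= q'l] ll'.
  rewrite -ll' in q'l *; congr (_, _).
  by have /card_le1_eqP := poor l lL; apply; rewrite !inE ?qP ?q'P.
rewrite -(card_in_imset snd_inj) subset_leq_card //.
by apply/subsetP => _ /imsetP[[q l] /setIdP[/setXP[_ lL] _] ->].
Qed.

Definition spanned_lines P L : {set {set F * F}} := [set l in L | (1 < #|P :&: l|)%N].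

Lemma card_incidences_le P L :
  (#|incidences P L| <= #|L| + #|incidences P (spanned_lines P L)|)%N.
Proof.
pose poor := L :\: spanned_lines P L.
have cover :
    incidences P L \subset incidences P poor :|: incidences P (spanned_lines P L).
  apply/subsetP => -[q l]; rewrite !inE /= => /andP[/andP[-> ->] ->] /=.
  by rewrite !andbT orNb.
apply: leq_trans (subset_leq_card cover) (leq_trans (leq_card_setU _ _) _).
rewrite leq_add2r.
apply: leq_trans (card_poor_incidences_le _) (subset_leq_card (subsetDl _ _)).
by move=> l; rewrite !inE => /andP[+ lL]; rewrite lL -leqNgt.
Qed.

End Collinearity.

Section Realization.
Variables (p : nat) (F : finFieldType) (K : numClosedFieldType).
Hypothesis pcharFp : p \in [pchar F].
Variables (P : {set F * F}) (L : {set {set F * F}}).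
Hypothesis lines : forall l, l \in L -> is_line l.
Hypothesis spanned : {in L, forall l, (1 < #|P :&: l|)%N}.

Local Notation PT := {q | q \in P}.
Local Notation LT := {l | l \in L}.

Lemma exists_realized_points : (lifting_bound #|P| < p)%N -> (#|P| ^ 2 < #|F|)%N ->
  exists x y : PT -> K, injective x /\ forall q0 q1 q2 : PT,
    (det3 x y q0 q1 q2 == 0) = (det3 fst snd (val q0) (val q1) (val q2) == 0).
Proof.
move=> ltp ltF; have [a a_inj] := exists_shear ltF.
have [||x [y [x_inj detE]]] :=
    exists_lifted_configuration (T := PT) (u := fun q => (val q).1 + a * (val q).2)
      (fun q => (val q).2) K pcharFp.
- by rewrite card_sig.
- by move=> q q' /a_inj eqq'; apply/val_inj/eqq'; apply: valP.
exists x, y; split=> // q0 q1 q2; rewrite detE; congr (_ == 0).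
by rewrite -(det3_shear fst snd a).
Qed.

Lemma exists_spanning_pair (l : LT) :
  exists qq : PT * PT, [/\ qq.1 != qq.2, val qq.1 \in val l & val qq.2 \in val l].
Proof.
have /card_gt1P[q [q' [/setIP[qP ql] /setIP[q'P q'l] nqq']]] := spanned (valP l).
by exists (Sub q qP, Sub q' q'P).
Qed.

Theorem exists_realization : (lifting_bound #|P| < p)%N -> (#|P| ^ 2 < #|F|)%N ->
  exists (x y : PT -> K) (s t : LT -> K),
    [/\ injective (fun q => (x q, y q)), injective (fun l => (s l, t l)) &
     forall q l, incident x y s t q l = (val q \in val l)].
Proof.
move=> ltp ltF; have [x [y [x_inj detE]]] := exists_realized_points ltp ltF.
have [f fP] := fin_all_exists exists_spanning_pair.
pose s l := (y (f l).2 - y (f l).1) / (x (f l).2 - x (f l).1).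
pose t l := y (f l).1 - s l * x (f l).1.
have incE q l : incident x y s t q l = (val q \in val l).
  have [n12 q1l q2l] := fP l.
  rewrite /incident on_chord_det3 ?detE ?(inj_eq x_inj) //.
  by rewrite (mem_line_det3 _ (lines (valP l)) _ q1l q2l).
exists x, y, s, t; split=> // [q q' [/x_inj]|l l' [sE tE]] //.
have on_l' (q : PT) : (val q \in val l) = (val q \in val l').
  by rewrite -!incE /incident sE tE.
have [n12 q1l q2l] := fP l; apply: val_inj.
by apply: (eq_line (lines (valP l)) (lines (valP l')) n12); rewrite -?on_l'.
Qed.

End Realization.

Lemma sqr_lt_lifting_bound n : (n ^ 2 < lifting_bound n)%N.
Proof.
apply: (@leq_ltn_trans (7 * n ^ 3 + 7)).
  by case: n => // n; apply: leq_trans (leq_addr _ _);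
    rewrite (leq_trans (leq_pexp2l _ (leqnSn 2))) // leq_pmull.
apply: leq_trans (ltn_expl _ (ltnSn 1)) _.
by rewrite leq_exp2l // -{1}[(_ + 7)%N]expn1 leq_pexp2l ?addn_gt0 ?orbT ?expn_gt0.
Qed.

Lemma leq_lifting_bound m n : (m <= n)%N -> (lifting_bound m <= lifting_bound n)%N.
Proof.
move=> lemn; rewrite leq_exp2l //.
have le_base : (7 * m ^ 3 + 7 <= 7 * n ^ 3 + 7)%N.
  by rewrite leq_add2r leq_mul2l leq_exp2r.
apply: (@leq_trans ((7 * n ^ 3 + 7) ^ (4 ^ (2 * m)))).
  by rewrite leq_exp2r // expn_gt0.
by rewrite leq_pexp2l ?addn_gt0 ?orbT // leq_exp2l // leq_mul2l.
Qed.

Lemma card_spanned_incidences_le (R : realType) (p n : nat) (F : finFieldType)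
    (P : {set F * F}) (L : {set {set F * F}}) :
  p \in [pchar F] -> (0 < n)%N -> (lifting_bound n < p)%N -> (p <= #|F|)%N ->
  (forall l, l \in L -> is_line l) -> {in L, forall l, (1 < #|P :&: l|)%N} ->
  (#|P| <= n)%N -> (#|L| <= n)%N ->
  #|incidences P L|%:R <= (rich_const R + 20) * n%:R `^ (4 / 3).
Proof.
move=> pcharFp n_gt0 ltp leF lines spanned cardP cardL.
have ltP : (lifting_bound #|P| < p)%N := leq_ltn_trans (leq_lifting_bound cardP) ltp.
have ltF : (#|P| ^ 2 < #|F|)%N.
  exact: leq_trans (sqr_lt_lifting_bound _) (leq_trans (ltnW ltP) leF).
have [x [y [s [t [points_inj lines_inj incE]]]]] :=
  exists_realization R[i] pcharFp lines spanned ltP ltF.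
have := szemeredi_trotter points_inj lines_inj n_gt0.
rewrite !card_sig => /(_ cardP cardL).
apply: le_trans; rewrite ler_nat.
pose pair (ql : {q | q \in P} * {l | l \in L}) := (val ql.1, val ql.2).
apply: leq_trans (leq_imset_card pair _); apply/subset_leq_card/subsetP => -[q l].
move=> /setIdP[/setXP[qP lL] ql]; apply/imsetP; exists (Sub q qP, Sub l lL) => //.
by rewrite inE incE.
Qed.

Theorem card_incidences_upper_bound (R : realType) (p n : nat) (F : finFieldType)
    (P : {set F * F}) (L : {set {set F * F}}) :
  p \in [pchar F] -> (0 < n)%N -> (lifting_bound n < p)%N -> (p <= #|F|)%N ->
  (forall l, l \in L -> is_line l) -> (#|P| <= n)%N -> (#|L| <= n)%N ->
  #|incidences P L|%:R <= (rich_const R + 21) * n%:R `^ (4 / 3).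
Proof.
move=> pcharFp n_gt0 ltp leF lines cardP cardL.
have spannedP l : l \in spanned_lines P L -> l \in L /\ (1 < #|P :&: l|)%N by move/setIdP.
have spanned_le : #|incidences P (spanned_lines P L)|%:R <=
    (rich_const R + 20) * n%:R `^ (4 / 3).
  apply: (card_spanned_incidences_le R pcharFp) => //.
  - by move=> l /spannedP[/lines].
  - by move=> l /spannedP[].
  - by apply: leq_trans cardL; apply/subset_leq_card/subsetP => l /spannedP[].
have := card_incidences_le P L; rewrite -(ler_nat R) natrD => /le_trans; apply.
have L_le : #|L|%:R <= n%:R `^ (4 / 3) :> R.
  apply: (@le_trans _ _ n%:R); first by rewrite ler_nat.
  by rewrite -[leLHS]powRr1 // ler_powR ?ler1n //; lra.
by lra.
Qed.

Lemma ltr_nat_expn_logb (R : realType) (b k : nat) (x : R) :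
  (1 < b)%N -> k%:R < logb b%:R x -> (b ^ k)%:R < x.
Proof.
move=> b_gt1; have lnb_gt0 : 0 < ln (b%:R : R) by rewrite ln_gt0 // ltr1n.
rewrite /logb ltr_pdivlMr // => lt_ln.
have x_gt0 : 0 < x.
  rewrite ltNge; apply/negP => /ln0 lnx0; move: lt_ln; rewrite lnx0 ltNge.
  by rewrite mulr_ge0 // ltW.
have b_gt0 : 0 < b%:R :> R by rewrite ltr0n ltnW.
by rewrite natrX -ltr_ln ?posrE ?exprn_gt0 // lnXn // -[ltLHS]mulr_natl.
Qed.

Lemma tower_lt (R : realType) (p n : nat) :
  5 * n%:R < logb 2 (logb 6 (logb 18 (p%:R : R))) - 1 ->
  (18 ^ (6 ^ (2 ^ (5 * n + 1))) < p)%N.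
Proof.
move=> lt_logb; have {lt_logb} : (5 * n + 1)%:R < logb 2 (logb 6 (logb 18 (p%:R : R))).
  by rewrite natrD natrM; lra.
move=> /(@ltr_nat_expn_logb R 2 _ _ isT) /(@ltr_nat_expn_logb R 6 _ _ isT).
by move=> /(@ltr_nat_expn_logb R 18 _ _ isT); rewrite ltr_nat.
Qed.

Lemma lifting_bound_le_tower n : (0 < n)%N ->
  (lifting_bound n <= 18 ^ (6 ^ (2 ^ (5 * n + 1))))%N.
Proof.
move=> n_gt0; rewrite /lifting_bound.
suff exponent_le : ((7 * n ^ 3 + 7) ^ (4 ^ (2 * n)) <= 6 ^ (2 ^ (5 * n + 1)))%N.
  apply: (@leq_trans (18 ^ ((7 * n ^ 3 + 7) ^ (4 ^ (2 * n))))%N).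
    by rewrite leq_exp2r // expn_gt0 addn_gt0 orbT.
  by rewrite leq_exp2l.
have -> : (6 ^ (2 ^ (5 * n + 1)) = (36 ^ (2 ^ n)) ^ (4 ^ (2 * n)))%N.
  have -> : (36 ^ (2 ^ n) = 6 ^ (2 ^ n.+1))%N by rewrite expnS expnM.
  have -> : (4 ^ (2 * n) = 2 ^ (4 * n))%N by rewrite !expnM.
  by rewrite -expnM -expnD; congr (_ ^ (_ ^ _))%N; lia.
rewrite leq_exp2r ?expn_gt0 //.
have ltn2 : (n < 2 ^ n)%N by exact: ltn_expl.
apply: (@leq_trans (36 ^ n.+1)); last by rewrite leq_exp2l.
have cube_le : (n ^ 3 <= 36 ^ n)%N.
  apply: (@leq_trans ((2 ^ n) ^ 3)); first by rewrite leq_exp2r // ltnW.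
  by rewrite -expnM mulnC expnM leq_exp2r.
have : (0 < 36 ^ n)%N by rewrite expn_gt0.
by rewrite [(36 ^ n.+1)%N]expnS; lia.
Qed.

Lemma lifting_bound_lt (R : realType) (p n : nat) : (0 < n)%N ->
  5 * n%:R < logb 2 (logb 6 (logb 18 (p%:R : R))) - 1 -> (lifting_bound n < p)%N.
Proof. by move=> /lifting_bound_le_tower le_tower /tower_lt; apply: leq_ltn_trans. Qed.

Section Grid.
Variables (p k : nat) (F : finFieldType).
Hypothesis pcharFp : p \in [pchar F].
Hypothesis k_gt0 : (0 < k)%N.

Definition grid_line (a b : nat) : {set F * F} :=
  [set q | 1 * q.2 + (- a%:R) * q.1 + (- b%:R) == 0].

Definition grid : {set F * F} :=
  [set (ij.1%:R, ij.2%:R) | ij : 'I_k * 'I_(2 * k ^ 2)].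

Definition grid_lines : {set {set F * F}} :=
  [set grid_line ab.1 ab.2 | ab : 'I_k * 'I_(k ^ 2)].

Lemma mem_grid_line (a b x y : nat) :
  ((x%:R, y%:R) \in grid_line a b) = (y%:R == (a * x + b)%:R :> F).
Proof.
rewrite inE /= mul1r mulNr natrD natrM -[RHS]subr_eq0.
by congr (_ == _); ring.
Qed.

Lemma grid_lines_are_lines l : l \in grid_lines -> is_line l.
Proof.
move=> /imsetP[ab _ ->]; exists 1, (- ab.1%:R), (- ab.2%:R); split=> //.
by case=> /eqP; rewrite oner_eq0.
Qed.

Lemma card_grid_le : (#|grid| <= 2 * k ^ 3)%N.
Proof.
apply: leq_trans (leq_imset_card _ _) _; rewrite card_prod !card_ord.
by rewrite mulnCA -expnS.
Qed.

Lemma card_grid_lines_le : (#|grid_lines| <= k ^ 3)%N.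
Proof.
by apply: leq_trans (leq_imset_card _ _) _; rewrite card_prod !card_ord -expnS.
Qed.

Lemma small_natr_inj i j : (i < p)%N -> (j < p)%N -> i%:R = j%:R :> F -> i = j.
Proof.
move=> ltip ltjp eqij; suff : i%:Z - j%:Z = 0 by lia.
apply: (small_intr_eq0 pcharFp); first lia.
by rewrite rmorphB /= -!pmulrn eqij subrr.
Qed.

Lemma grid_line_inj a b a' b' : (a + b < p)%N -> (a' + b' < p)%N ->
  grid_line a b = grid_line a' b' -> a = a' /\ b = b'.
Proof.
move=> ltp ltp' eq_line.
have at0 : (0%:R, b%:R) \in grid_line a' b' by rewrite -eq_line mem_grid_line muln0.
have at1 : (1%:R, (a + b)%:R) \in grid_line a' b' by rewrite -eq_line mem_grid_line muln1.
rewrite mem_grid_line muln0 in at0; rewrite mem_grid_line muln1 in at1.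
have bb' : b = b' by apply: small_natr_inj (eqP at0); lia.
have aabb' : (a + b = a' + b')%N by apply: small_natr_inj (eqP at1).
by split=> //; lia.
Qed.

Lemma card_grid_incidences_ge : (2 * k ^ 3 < p)%N ->
  (k ^ 4 <= #|incidences grid grid_lines|)%N.
Proof.
move=> ltp; have le_sqr : (k <= k ^ 2)%N by rewrite -{1}[k]expn1 leq_pexp2l.
have le_cube : (k ^ 2 <= k ^ 3)%N by rewrite leq_pexp2l.
pose flag (t : 'I_k * 'I_k * 'I_(k ^ 2)) : (F * F) * {set F * F} :=
  ((t.1.1%:R, (t.1.2 * t.1.1 + t.2)%:R), grid_line t.1.2 t.2).
have flag_inj : injective flag.
  move=> [[x a] b] [[x' a'] b'] [eqx _ eql].
  have [lta ltb lta' ltb'] := And4 (ltn_ord a) (ltn_ord b) (ltn_ord a') (ltn_ord b').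
  have [||/val_inj -> /val_inj ->] := grid_line_inj _ _ eql; [lia..|].
  congr (_, _, _); apply/ord_inj/small_natr_inj => //.
    by have := ltn_ord x; lia.
  by have := ltn_ord x'; lia.
have <- : #|[set flag t | t : 'I_k * 'I_k * 'I_(k ^ 2)]| = (k ^ 4)%N.
  by rewrite card_imset // !card_prod !card_ord mulnn -expnD.
apply/subset_leq_card/subsetP => _ /imsetP[[[x a] b] _ ->].
rewrite inE inE /= mem_grid_line eqxx andbT; apply/andP; split; last first.
  by apply/imsetP; exists (a, b).
have lty : (a * x + b < 2 * k ^ 2)%N.
  have := leq_mul (ltnW (ltn_ord a)) (ltnW (ltn_ord x)); have := ltn_ord b.
  by rewrite mulnn; lia.
by apply/imsetP; exists (x, Ordinal lty).
Qed.

End Grid.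

Lemma exists_half_cube_root n : (2 <= n)%N ->
  exists2 k, (0 < k)%N & (2 * k ^ 3 <= n < 2 * k.+1 ^ 3)%N.
Proof.
move=> n_ge2; pose P k := (2 * k ^ 3 <= n)%N.
have exP : exists k, P k by exists 1%N.
have leP k : P k -> (k <= n)%N.
  rewrite /P => le_n; apply: leq_trans le_n; case: k => // k.
  by rewrite 2!expnS mulnA; nia.
have [k Pk kmax] := ex_maxnP exP leP; exists k; first exact: (kmax 1%N).
by rewrite [(2 * k ^ 3 <= n)%N]Pk /= ltnNge; apply/negP => /kmax; rewrite ltnn.
Qed.

Theorem card_incidences_lower_bound (R : realType) (p n : nat) (F : finFieldType) :
  p \in [pchar F] -> (8 <= n < p)%N ->
  exists (P : {set F * F}) (L : {set {set F * F}}),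
    [/\ forall l, l \in L -> is_line l, (#|P| <= n)%N, (#|L| <= n)%N &
        81^-1 * n%:R `^ (4 / 3) <= #|incidences P L|%:R :> R].
Proof.
move=> pcharFp /andP[n_ge8 ltnp].
have n_ge2 : (2 <= n)%N by apply: leq_trans n_ge8.
have [k k_gt0 /andP[le_n lt_n]] := exists_half_cube_root n_ge2.
exists (grid k F), (grid_lines k F); split.
- exact: grid_lines_are_lines.
- exact: leq_trans (card_grid_le _ _) le_n.
- apply: leq_trans (card_grid_lines_le _ _) (leq_trans _ le_n).
  by rewrite leq_pmull.
have := card_grid_incidences_ge pcharFp k_gt0 (leq_ltn_trans le_n ltnp).
rewrite -(ler_nat R); apply: le_trans; rewrite mulrC ler_pdivrMr //.
have n_le : n%:R <= (3 * k)%:R ^+ 3 :> R.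
  rewrite -natrX ler_nat; apply: ltnW; apply: leq_trans lt_n _.
  apply: (@leq_trans (2 * (2 * k) ^ 3)); first by rewrite leq_mul2l leq_exp2r //; lia.
  by rewrite !expnMn mulnA leq_mul2r orbT.
have exponent_ge0 : 0 <= 4 / 3 :> R by lra.
have := ge0_ler_powR exponent_ge0 (ler0n R n : n%:R \is Num.nneg) _ n_le.
rewrite nnegrE exprn_ge0 // => /(_ isT) /le_trans; apply.
rewrite -powR_mulrn // -powRrM.
have -> : 3%:R * (4 / 3) = 4%:R :> R by field.
by rewrite powR_mulrn // -natrX -[81]/(81%:R) -natrM expnMn mulnC.
Qed.

Theorem theorem2p3 (R : realType) :
  (exists c : R, 0 < c /\
    forall p n : nat, prime p -> (0 < n)%N ->
      5 * n%:R < logb 2 (logb 6 (logb 18 (p%:R : R))) - 1 ->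
      forall (P : {set 'F_p * 'F_p}) (L : {set {set 'F_p * 'F_p}}),
        (forall l, l \in L -> is_line l) ->
        (#|P| <= n)%N -> (#|L| <= n)%N ->
        #|incidences P L|%:R <= c * n%:R `^ (4 / 3))
  /\
  (exists c' : R, 0 < c' /\
    forall p n : nat, prime p -> (8 <= n)%N ->
      5 * n%:R < logb 2 (logb 6 (logb 18 (p%:R : R))) - 1 ->
      exists (P : {set 'F_p * 'F_p}) (L : {set {set 'F_p * 'F_p}}),
        [/\ forall l, l \in L -> is_line l,
            (#|P| <= n)%N, (#|L| <= n)%N &
            c' * n%:R `^ (4 / 3) <= #|incidences P L|%:R]).
Proof.
split.
  exists (rich_const R + 21); split; first by have := rich_const_gt0 R; lra.
  move=> p n p_prime n_gt0 /(lifting_bound_lt n_gt0) ltp P L.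
  by apply: (card_incidences_upper_bound R (pchar_Fp p_prime)); rewrite ?card_Fp.
exists 81^-1; split=> [|p n p_prime n_ge8]; first by rewrite invr_gt0.
have n_gt0 : (0 < n)%N by apply: leq_trans n_ge8.
move=> /(lifting_bound_lt n_gt0) ltp.
apply: (card_incidences_lower_bound R (pchar_Fp p_prime)); rewrite n_ge8 /=.
apply: leq_ltn_trans ltp; apply: leq_trans (ltnW (sqr_lt_lifting_bound n)).
by rewrite -{1}[n]expn1 leq_pexp2l.
Qed.
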